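(* Let $\mathcal{X}$ be a Banach space and let $\mathcal{B}(\mathcal{X})$ be the algebra of bounded linear operators on $\mathcal{X}$. If $M\subset\mathcal{B}(\mathcal{X})$ is precompact (in the operator norm), then $$\rho(M)=\max\{\rho_\chi(M),\,r(M)\}.$$
   Context: All spaces are over $\mathbb{C}$. Products of sets of operators are elementwise: $M_1M_2=\{ab:a\in M_1,b\in M_2\}$, and $M^n$ is the $n$-fold product. The norm of a bounded set is $\|M\|=\sup_{a\in M}\|a\|$. The joint spectral radius of a bounded set is $\rho(M)=\lim_{n\to\infty}\|M^n\|^{1/n}=\inf_n\|M^n\|^{1/n}$; for a single operator $a$, $\rho(a)=\rho(\{a\})$ is the usual spectral radius. The Berger-Wang radius is $r(M)=\limsup_{n\to\infty}\left(\sup\{\rho(a):a\in M^n\}\right)^{1/n}$. For an operator $T$ on $\mathcal{X}$ with closed unit ball $\mathcal{X}_1$, $\|T\|_\chi$ is the Hausdorff measure of non-compactness of $T\mathcal{X}_1$, i.e. the infimum of all $\varepsilon>0$ such that $T\mathcal{X}_1$ can be covered by finitely many balls of radius $\varepsilon$. For a bounded set $M$ of operators, $\rho_\chi(M)=\limsup_{n\to\infty}\left(\sup\{\|T\|_\chi:T\in M^n\}\right)^{1/n}$. *)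

(* Defs.v *)
From HB Require Import structures.
From mathcomp Require Import all_boot all_order all_algebra.
From mathcomp Require Import complex.
From mathcomp Require Import all_classical all_reals all_analysis.

Set Implicit Arguments.
Unset Strict Implicit.
Unset Printing Implicit Defensive.

Import Order.TTheory GRing.Theory Num.Theory.
Import numFieldNormedType.Exports.

Local Open Scope classical_set_scope.
Local Open Scope ring_scope.
Local Open Scope complex_scope.

(* The norm of a normed space over R[i] takes its values in R[i], where it is
   a nonnegative real; [rnorm] is the same number as an element of R. *)
Definition rnorm (R : realType) (V : normedModType R[i]) (v : V) : R :=
  complex.Re `|v|.

Section BoundedOperators.
Context (R : realType) (X : normedModType R[i]).

Definition is_bounded_op : {pred X -> X} :=
  mem [set f : X -> X | linear f /\ continuous f].

Record bounded_op := BoundedOp {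
  bounded_op_fun :> X -> X;
  bounded_opP : bounded_op_fun \in is_bounded_op }.

HB.instance Definition _ := [isSub for bounded_op_fun].
HB.instance Definition _ := [Choice of bounded_op by <:].

Lemma bounded_op_linear (T : bounded_op) : linear T.
Proof. by have := bounded_opP T; rewrite inE => -[]. Qed.

Lemma bounded_op_continuous (T : bounded_op) : continuous T.
Proof. by have := bounded_opP T; rewrite inE => -[]. Qed.

HB.instance Definition _ (T : bounded_op) :=
  GRing.isLinear.Build R[i] X X *:%R (bounded_op_fun T) (bounded_op_linear T).

Lemma is_bounded_op_submod_closed : GRing.submod_closed is_bounded_op.
Proof.
split=> [|a f g].
  rewrite inE; split=> [b u v|x]; first by rewrite /= scaler0 addr0.
  exact: cst_continuous.
rewrite !inE => -[lf cf] [lg cg]; split=> [b u v|x].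
  suff : a *: f (b *: u + v) + g (b *: u + v) =
         b *: (a *: f u + g u) + (a *: f v + g v) by [].
  by rewrite lf lg !scalerDr !scalerA [b * a]mulrC addrACA.
apply: (@continuousD _ _ _ (a *: f) g); last exact: cg.
by apply: continuousZr; exact: cf.
Qed.

HB.instance Definition _ := GRing.isSubmodClosed.Build R[i] (X -> X)
  is_bounded_op is_bounded_op_submod_closed.
HB.instance Definition _ := [SubChoice_isSubLmodule of bounded_op by <:].

Definition opnorm (T : bounded_op) : R :=
  sup [set rnorm (T x) | x in [set x : X | `|x| <= 1]].

Lemma rnormE (v : X) : `|v| = (rnorm v)%:C.
Proof.
rewrite /rnorm; have := normr_ge0 v.
by case: `|v| => a b; rewrite lecE /= => /andP[/eqP -> _].
Qed.

Lemma rnorm_le (v w : X) : (rnorm v <= rnorm w) = (`|v| <= `|w|).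
Proof. by rewrite !rnormE lecR. Qed.

Lemma opnorm_has_sup (T : bounded_op) :
  has_sup [set rnorm (T x) | x in [set x : X | `|x| <= 1]].
Proof.
split; first by exists (rnorm (T 0)), 0 => //=; rewrite normr0.
have [_ /(_ (@bounded_op_continuous T))] := linear_bounded_continuous T.
move=> /bounded_funP /(_ 1)[b Tb].
exists (complex.Re b) => _ [x /= x1 <-].
by have := Tb _ x1; rewrite /rnorm lecE => /andP[].
Qed.

Lemma opnorm_ge (T : bounded_op) (x : X) : `|x| <= 1 -> rnorm (T x) <= opnorm T.
Proof.
by move=> x1; apply: (sup_upper_bound (opnorm_has_sup T)); exists x.
Qed.

Lemma opnorm_le (T : bounded_op) (r : R) :
  (forall x : X, `|x| <= 1 -> rnorm (T x) <= r) -> opnorm T <= r.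
Proof.
move=> Tr; apply: ge_sup; first by have [] := opnorm_has_sup T.
by move=> _ [x /= x1 <-]; exact: Tr.
Qed.

Lemma opnorm_ge0 (T : bounded_op) : 0 <= opnorm T.
Proof.
apply: le_trans (opnorm_ge T (x := 0) _); last by rewrite normr0.
by rewrite linear0 /rnorm normr0.
Qed.

Lemma opnorm_normD (S T : bounded_op) :
  (opnorm (S + T))%:C <= (opnorm S)%:C + (opnorm T)%:C.
Proof.
rewrite -rmorphD lecR; apply: opnorm_le => x x1.
apply: le_trans (lerD (opnorm_ge S x1) (opnorm_ge T x1)).
by rewrite -lecR rmorphD /= -!rnormE ler_normD.
Qed.

Lemma opnormZ_le (a : R[i]) (T : bounded_op) :
  (opnorm (a *: T))%:C <= `|a| * (opnorm T)%:C.
Proof.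
have aE : `|a| = (complex.Re `|a|)%:C.
  have := normr_ge0 a.
  by case: `|a| => b c; rewrite lecE /= => /andP[/eqP -> _].
rewrite aE -rmorphM lecR; apply: opnorm_le => x x1.
rewrite -lecR rmorphM /= -aE -rnormE.
rewrite -[X in X <= _]/`|a *: T x|.
by rewrite normrZ ler_wpM2l// rnormE lecR opnorm_ge.
Qed.

Lemma opnormZ (a : R[i]) (T : bounded_op) :
  (opnorm (a *: T))%:C = `|a| * (opnorm T)%:C.
Proof.
apply/eqP; rewrite eq_le opnormZ_le /=.
have [->|a0] := eqVneq a 0.
  by rewrite normr0 mul0r lecR opnorm_ge0.
rewrite mulrC -ler_pdivlMr ?normr_gt0// mulrC -normfV.
apply: le_trans (opnormZ_le a^-1 (a *: T)).
by rewrite scalerA mulVf// scale1r.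
Qed.

Lemma opnorm_eq0 (T : bounded_op) : (opnorm T)%:C = 0 -> T = 0.
Proof.
move=> /eqP; rewrite -[0]/(0%:C) (inj_eq (@complexI R)) => /eqP T0.
apply/val_inj/funext => x /=.
have [->|x0] := eqVneq x 0; first by rewrite linear0.
have nx0 : `|x| != 0 by rewrite normr_eq0.
have := @opnorm_ge T (`|x|^-1 *: x).
rewrite normrZ normfV normr_id mulVf// lexx => /(_ isT).
rewrite T0 -lecR -rnormE linearZ normr_le0 scaler_eq0 invr_eq0 (negbTE nx0).
by move=> /eqP.
Qed.

(* From here on topological notions for sets of operators, such as
   [precompact], refer to the operator norm. *)
HB.instance Definition _ := Lmodule_isNormed.Build R[i] bounded_op
  opnorm_normD opnormZ opnorm_eq0.

End BoundedOperators.

Arguments bounded_op {R} X.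

Section SetsOfOperators.
Context (R : realType) (X : normedModType R[i]).
Implicit Types (S T : bounded_op X) (M N : set (bounded_op X)).

Lemma rnorm_bounded_op T : rnorm T = opnorm T.
Proof. by []. Qed.

Lemma idfun_bounded : (idfun : X -> X) \in @is_bounded_op R X.
Proof. by rewrite inE; split=> // x; exact: cvg_id. Qed.

Definition op_id : bounded_op X := BoundedOp idfun_bounded.

Lemma comp_bounded S T : (S \o T : X -> X) \in @is_bounded_op R X.
Proof.
rewrite inE; split=> [a u v|x]; first by rewrite /= !linearP.
by apply: continuous_comp; exact: bounded_op_continuous.
Qed.

Definition op_comp S T : bounded_op X := BoundedOp (comp_bounded S T).

Definition opset_mul M N : set (bounded_op X) :=
  [set op_comp a b | a in M & b in N].

Definition opset_exp M n : set (bounded_op X) :=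
  iter n (opset_mul M) [set op_id].

Definition opset_norm M : R := sup [set opnorm a | a in M].

(* In the three radii below the n = 0 term, where 0^-1 = 0, does not affect the
   limit.  The suprema are real-valued, with [sup set0 = 0]; for bounded M they
   are all finite and [limn], [limn_sup] are the usual limit and upper limit. *)
Definition joint_spectral_radius M : R :=
  limn (fun n => opset_norm (opset_exp M n) `^ n%:R^-1).

Definition spectral_radius T : R := joint_spectral_radius [set T].

Definition berger_wang_radius M : R :=
  limn_sup (fun n =>
    sup [set spectral_radius a | a in opset_exp M n] `^ n%:R^-1).

(* [ball] takes its radius in the scalar field, hence the cast of e to R[i]. *)
Definition hausdorff_noncompactness (A : set X) : R :=
  inf [set e | 0 < e /\ exists2 F : set X, finite_set F &
                          A `<=` \bigcup_(c in F) ball c e%:C].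

Definition chi_norm T : R :=
  hausdorff_noncompactness [set T x | x in [set x : X | `|x| <= 1]].

Definition chi_spectral_radius M : R :=
  limn_sup (fun n =>
    sup [set chi_norm a | a in opset_exp M n] `^ n%:R^-1).

End SetsOfOperators.

(* Main.v *)
Require Import Defs.
From mathcomp Require Import all_boot all_order all_algebra.
From mathcomp Require Import complex.
From mathcomp Require Import all_classical all_reals all_analysis.
From mathcomp Require Import perm.
From mathcomp Require Import zify ring lra.

(** Both radii on the right are at most the joint spectral radius, because
    [chi_norm] and [spectral_radius] are dominated by the operator norm.  For the
    other inequality scale M so that its joint spectral radius is 1 and suppose
    that [chi_norm] decays exponentially along the powers of M.  It suffices to
    find, for every g > 1, a product b of n elements of M and a vector v <> 0 with
    |b^p v| >= g^(-np) |v| for all p ([near_eigenvector]): then the spectral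
    radius of b is at least g^(-n), and that of its powers likewise.

    The tool is a volume [vol x] of a k-tuple x: it is multiplied by |det T| under
    a change of basis T, and by at most |b|^k under an operator b.  Say that M
    contracts k-volumes if all products of some fixed length shrink them by a
    factor c < 1.  M does not contract 1-volumes, since these are norms.  It
    contracts k-volumes for large k ([vol_contracting_large]): an operator that
    almost keeps a k-volume expands a k-dimensional ball in all directions, so its
    image of the unit ball contains many separated points, whereas the small
    measure of non-compactness covers the image of a long product by few small
    balls.  Hence some k has the property that M contracts (k+1)-volumes but not
    k-volumes.

    For this k and every n there are a word a_0 ... a_(n-1) and k-dimensional
    spaces E_t = span (y_t) with E_t = a_t E_(t+1), such that the volumes d_t of
    the y_t satisfy d_0 >= d_n / 2.  Call j good if d_t is not much smaller than
    d_j, relative to the length j - t, for all t < j.  Good times are record minima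
    of a sequence that falls with bounded steps, so there are many of them
    ([many_records]).  For a good j the products a_t ... a_(j-1) cannot contract
    E_j by much ([expansion]), while they contract the quotients X/E_j -> X/E_t
    strongly, because they contract (k+1)-volumes ([contraction]).  The unit balls
    of the E_j lie near a fixed finite set, so that two good times i < j have
    almost the same space, by the pigeonhole principle ([slow_return]).  The
    product a_i ... a_(j-1) then maps a narrow cone around E_j into itself and
    hardly shrinks its vectors ([cone_invariant]), so it can be iterated. *)

Set Implicit Arguments.
Unset Strict Implicit.
Unset Printing Implicit Defensive.

Import Order.TTheory GRing.Theory Num.Theory.
Import numFieldNormedType.Exports.

Local Open Scope classical_set_scope.
Local Open Scope ring_scope.

(** * Moduli and norms *)

Section Norms.
Context (R : realType).

Definition modc (z : R[i]) : R := complex.Re `|z|.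

Lemma normcE_modc (z : R[i]) : `|z| = (modc z)%:C%C.
Proof.
have := normr_ge0 z; rewrite /modc.
by case: `|z| => a b; rewrite lecE /= => /andP[/eqP -> _].
Qed.

Lemma modc_ge0 z : 0 <= modc z.
Proof. by rewrite -ler0c -normcE_modc. Qed.

Lemma modc0 : modc 0 = 0.
Proof. by rewrite /modc normr0. Qed.

Lemma modc1 : modc 1 = 1.
Proof. by rewrite /modc normr1. Qed.

Lemma modcM z w : modc (z * w) = modc z * modc w.
Proof.
by apply: (@complexI R); rewrite rmorphM /= -!normcE_modc normrM.
Qed.

Lemma modcV z : modc z^-1 = (modc z)^-1.
Proof.
by apply: (@complexI R); rewrite fmorphV /= -!normcE_modc normfV.
Qed.

Lemma modc_eq0 z : (modc z == 0) = (z == 0).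
Proof.
by rewrite -(inj_eq (@complexI R)) -normcE_modc normr_eq0.
Qed.

Lemma modc_gt0 z : (0 < modc z) = (z != 0).
Proof. by rewrite lt_neqAle modc_ge0 andbT eq_sym modc_eq0. Qed.

Lemma modc_real (r : R) : modc r%:C%C = `|r|.
Proof.
apply: (@complexI R); rewrite -normcE_modc.
have [r0|r0] := leP 0 r.
  by rewrite !ger0_norm ?ler0c.
by rewrite !ltr0_norm ?rmorphN// -(rmorph0 (real_complex R)) ltcR.
Qed.

Lemma modcD_le z w : modc (z + w) <= modc z + modc w.
Proof. by rewrite -lecR rmorphD /= -!normcE_modc ler_normD. Qed.

Lemma modc_prod (I : Type) (r : seq I) (P : pred I) (F : I -> R[i]) :
  modc (\prod_(i <- r | P i) F i) = \prod_(i <- r | P i) modc (F i).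
Proof. exact: (big_morph modc modcM modc1). Qed.

Lemma modc_sum_le (I : Type) (r : seq I) (P : pred I) (F : I -> R[i]) :
  modc (\sum_(i <- r | P i) F i) <= \sum_(i <- r | P i) modc (F i).
Proof.
elim/big_rec2: _ => [|i y x _ yx]; first by rewrite modc0.
exact: (le_trans (modcD_le _ _) (lerD _ _)).
Qed.

Context (X : normedModType R[i]).
Implicit Types u v : X.

Lemma rnorm_ge0 v : 0 <= rnorm v.
Proof. by rewrite -ler0c -rnormE. Qed.

Lemma rnorm0 : rnorm (0 : X) = 0.
Proof. by rewrite /rnorm normr0. Qed.

Lemma rnormD_le u v : rnorm (u + v) <= rnorm u + rnorm v.
Proof. by rewrite -lecR rmorphD /= -!rnormE ler_normD. Qed.

Lemma rnormN v : rnorm (- v) = rnorm v.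
Proof. by rewrite /rnorm normrN. Qed.

Lemma rnormB_sym u v : rnorm (u - v) = rnorm (v - u).
Proof. by rewrite -rnormN opprB. Qed.

Lemma rnormB_le u v : rnorm (u - v) <= rnorm u + rnorm v.
Proof. by rewrite -(rnormN v) rnormD_le. Qed.

Lemma rnorm_triangle (w u v : X) : rnorm (u - v) <= rnorm (u - w) + rnorm (w - v).
Proof. by rewrite (le_trans _ (rnormD_le _ _))// addrA subrK. Qed.

Lemma rnorm_le_sub u v : rnorm u <= rnorm (u - v) + rnorm v.
Proof. by rewrite -{1}(subrK v u) rnormD_le. Qed.

Lemma rnormZ (a : R[i]) v : rnorm (a *: v) = modc a * rnorm v.
Proof.
by apply: (@complexI R); rewrite rmorphM /= -rnormE -normcE_modc -rnormE normrZ.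
Qed.

Lemma rnorm_eq0 v : (rnorm v == 0) = (v == 0).
Proof. by rewrite -(inj_eq (@complexI R)) -rnormE normr_eq0. Qed.

Lemma rnorm_gt0 v : (0 < rnorm v) = (v != 0).
Proof. by rewrite lt_neqAle rnorm_ge0 andbT eq_sym rnorm_eq0. Qed.

Lemma rnorm_sum_le (I : Type) (r : seq I) (P : pred I) (F : I -> X) :
  rnorm (\sum_(i <- r | P i) F i) <= \sum_(i <- r | P i) rnorm (F i).
Proof.
elim/big_rec2: _ => [|i y x _ yx]; first by rewrite rnorm0.
exact: (le_trans (rnormD_le _ _) (lerD _ _)).
Qed.

Lemma opnormP (T : bounded_op X) v : rnorm (T v) <= opnorm T * rnorm v.
Proof.
have [->|v0] := eqVneq v 0; first by rewrite linear0 rnorm0 mulr0.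
have nv : 0 < rnorm v by rewrite rnorm_gt0.
rewrite -ler_pdivrMr//.
have := @opnorm_ge _ _ T (((rnorm v)^-1)%:C%C *: v).
rewrite linearZ/= rnormZ modc_real gtr0_norm ?invr_gt0// mulrC; apply.
by rewrite rnormE rnormZ modc_real gtr0_norm ?invr_gt0// mulVf ?gt_eqF.
Qed.

Lemma opnorm_leP (T : bounded_op X) (r : R) : 0 <= r ->
  (forall v, rnorm (T v) <= r * rnorm v) -> opnorm T <= r.
Proof.
move=> r0 Tr; apply: opnorm_le => x.
rewrite rnormE -(rmorph1 (real_complex R)) lecR => x1.
by rewrite (le_trans (Tr x))// ler_piMr.
Qed.

Lemma opnorm_comp (S T : bounded_op X) : opnorm (op_comp S T) <= opnorm S * opnorm T.
Proof.
apply: opnorm_leP => [|v]; first by rewrite mulr_ge0 ?opnorm_ge0.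
rewrite (le_trans (opnormP S (T v)))// -mulrA.
by rewrite ler_wpM2l ?opnorm_ge0 ?opnormP.
Qed.

End Norms.

(** * Volumes of tuples *)

Section Volume.
Context (R : realType) (X : normedModType R[i]).

Definition comb k (x : 'I_k -> X) (c : 'I_k -> R[i]) : X := \sum_i c i *: x i.

Definition in_span k (x : 'I_k -> X) (v : X) := exists c, v = comb x c.

Definition recomb k (x : 'I_k -> X) (T : 'M[R[i]]_k) : 'I_k -> X :=
  fun j => comb x (T^~ j).

(** The candidates for the volume of the parallelepiped spanned by x: each basis
    of the same span estimates it from above by the product of its norms, corrected
    by the determinant of the change of basis. *)
Definition vol_set k (x : 'I_k -> X) : set R :=
  [set (\prod_j rnorm (recomb x T j)) / modc (\det T)
     | T in [set T | T \in unitmx]].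

(** Up to a factor that depends on k only, the square of [vol x] is the Lebesgue
    measure, in 2k real dimensions, of the combinations of x with coefficients in
    the unit disc, when the unit ball of the span has measure 1.  Taking an infimum
    over all bases makes the transformation rule [vol_recomb] exact.  The
    volume vanishes on dependent tuples. *)
Definition vol k (x : 'I_k -> X) : R := inf (vol_set x).

Lemma recombM k (x : 'I_k -> X) S T : recomb (recomb x S) T = recomb x (S *m T).
Proof.
apply/funext => j; rewrite /recomb /comb.
under eq_bigr => i _ do rewrite scaler_sumr.
rewrite exchange_big /=; apply: eq_bigr => i _.
rewrite mxE scaler_suml; apply: eq_bigr => l _.
by rewrite scalerA mulrC.
Qed.

Lemma recomb1 k (x : 'I_k -> X) : recomb x 1%:M = x.
Proof.
apply/funext => j; rewrite /recomb /comb (bigD1 j)//= big1 ?addr0 => [|i /negPf ij].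
  by rewrite mxE eqxx scale1r.
by rewrite mxE ij scale0r.
Qed.

Lemma comb_linear k (x : 'I_k -> X) (b : bounded_op X) c : b (comb x c) = comb (b \o x) c.
Proof. by rewrite linear_sum; apply: eq_bigr => i _; rewrite linearZ. Qed.

Lemma recomb_linear k (x : 'I_k -> X) (b : bounded_op X) T :
  b \o recomb x T = recomb (b \o x) T.
Proof. by apply/funext => j; rewrite /= comb_linear. Qed.

Lemma comb_recomb k (x : 'I_k -> X) T c :
  comb (recomb x T) c = comb x (fun i => \sum_j T i j * c j).
Proof.
rewrite /comb; under eq_bigr => i _ do rewrite scaler_sumr.
rewrite exchange_big /=; apply: eq_bigr => i _; rewrite scaler_suml.
by apply: eq_bigr => l _; rewrite scalerA mulrC.
Qed.

Lemma in_span_recomb k (x : 'I_k -> X) T v : T \in unitmx ->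
  in_span (recomb x T) v <-> in_span x v.
Proof.
move=> uT; split=> -[c ->].
  by rewrite comb_recomb; eexists.
by rewrite -[x in comb x _]recomb1 -(mulmxV uT) -recombM comb_recomb; eexists.
Qed.

Lemma in_span0 k (x : 'I_k -> X) : in_span x 0.
Proof. by exists (fun=> 0); rewrite /comb big1// => i _; rewrite scale0r. Qed.

Lemma in_span_tuple k (x : 'I_k -> X) i : in_span x (x i).
Proof.
exists (fun j => (j == i)%:R); rewrite /comb (bigD1 i)//= eqxx scale1r big1 ?addr0//.
by move=> j /negPf->; rewrite scale0r.
Qed.

Lemma in_spanD k (x : 'I_k -> X) u v : in_span x u -> in_span x v -> in_span x (u + v).
Proof.
move=> [c ->] [d ->]; exists (fun i => c i + d i).
by rewrite /comb -big_split; apply: eq_bigr => i _; rewrite scalerDl.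
Qed.

Lemma in_spanZ k (x : 'I_k -> X) a u : in_span x u -> in_span x (a *: u).
Proof.
move=> [c ->]; exists (fun i => a * c i).
by rewrite /comb scaler_sumr; apply: eq_bigr => i _; rewrite scalerA.
Qed.

Lemma in_spanB k (x : 'I_k -> X) u v : in_span x u -> in_span x v -> in_span x (u - v).
Proof. by move=> xu xv; rewrite -scaleN1r; apply: in_spanD => //; exact: in_spanZ. Qed.

Lemma in_span_image k (x : 'I_k -> X) (b : bounded_op X) v :
  in_span x v -> in_span (b \o x) (b v).
Proof. by move=> [c ->]; exists c; rewrite comb_linear. Qed.

Lemma in_span_imageP k (x : 'I_k -> X) (b : bounded_op X) v : in_span (b \o x) v ->
  exists2 u, in_span x u & v = b u.
Proof. by move=> [c ->]; exists (comb x c); [exists c|rewrite comb_linear]. Qed.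

Lemma vol_has_inf k (x : 'I_k -> X) : has_inf (vol_set x).
Proof.
split.
  exists ((\prod_j rnorm (recomb x 1%:M j)) / modc (\det (1%:M : 'M[R[i]]_k))).
  by exists 1%:M => //=; exact: unitmx1.
exists 0 => _ [T _ <-]; rewrite divr_ge0 ?modc_ge0// prodr_ge0// => j _.
exact: rnorm_ge0.
Qed.

Lemma vol_ge k (x : 'I_k -> X) r :
  (forall T, T \in unitmx -> r * modc (\det T) <= \prod_j rnorm (recomb x T j)) -> r <= vol x.
Proof.
move=> h; apply: lb_le_inf; first exact: (vol_has_inf x).1.
move=> _ [T /= uT <-]; rewrite ler_pdivlMr ?h// modc_gt0.
by rewrite unitmxE unitfE in uT.
Qed.

Lemma vol_recomb_le k (x : 'I_k -> X) T : T \in unitmx ->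
  vol x * modc (\det T) <= \prod_j rnorm (recomb x T j).
Proof.
move=> uT; rewrite -ler_pdivlMr; last by rewrite modc_gt0 -unitfE -unitmxE.
by apply: ge_inf; [exact: (vol_has_inf x).2|exists T].
Qed.

Lemma vol_ge0 k (x : 'I_k -> X) : 0 <= vol x.
Proof.
by apply: vol_ge => T uT; rewrite mul0r prodr_ge0// => j _; exact: rnorm_ge0.
Qed.

Lemma vol_le k (x : 'I_k -> X) : vol x <= \prod_j rnorm (x j).
Proof.
by have := vol_recomb_le x (unitmx1 _ _); rewrite det1 modc1 mulr1 recomb1.
Qed.

Lemma vol_recomb k (x : 'I_k -> X) T : T \in unitmx ->
  vol (recomb x T) = modc (\det T) * vol x.
Proof.
have le S y : S \in unitmx -> modc (\det S) * vol y <= vol (recomb y S).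
  move=> uS; apply: vol_ge => U uU; rewrite recombM.
  rewrite mulrAC -modcM -det_mulmx mulrC vol_recomb_le//.
  by rewrite unitmx_mul uS.
move=> uT; apply/eqP; rewrite eq_le le// andbT.
have := le _ (invmx T) (recomb x T); rewrite unitmx_inv => /(_ uT).
rewrite recombM mulmxV// recomb1 det_inv modcV mulrC ler_pdivrMr.
  by rewrite mulrC.
by rewrite modc_gt0 -unitfE -unitmxE.
Qed.

(** The image under b of a basis competing for [vol x] competes for the volume of
    the image, with all norms multiplied by at most A. *)
Lemma vol_image_le k (x : 'I_k -> X) (b : bounded_op X) A :
  (forall v, rnorm (b v) <= A * rnorm v) -> 0 <= A -> vol (b \o x) <= A ^+ k * vol x.
Proof.
move=> bA A0; have [A0'|A0'] := eqVneq A 0; last first.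
  have Ap : 0 < A by rewrite lt_neqAle eq_sym A0'.
  rewrite -ler_pdivrMl ?exprn_gt0//; apply: vol_ge => T uT.
  rewrite -mulrA ler_pdivrMl ?exprn_gt0//.
  apply: le_trans (vol_recomb_le _ uT) _; rewrite -recomb_linear.
  have -> : A ^+ k = \prod_(j < k) A by rewrite prodr_const card_ord.
  rewrite -big_split /=; apply: ler_prod => j _.
  by rewrite rnorm_ge0 bA.
case: k x => [|k] x.
  rewrite expr0 mul1r; apply: vol_ge => T uT.
  by have := vol_recomb_le (b \o x) uT; rewrite !big_ord0.
rewrite A0' expr0n mul0r; apply: le_trans (vol_le _) _.
rewrite big_ord_recl /=; move: (bA (x ord0)); rewrite A0' mul0r => h.
rewrite (@le_anti _ _ (rnorm (b (x ord0))) 0) ?mul0r//.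
by rewrite h rnorm_ge0.
Qed.

End Volume.

(** * Almost Auerbach bases and adjoined vectors *)

Section Auerbach.
Context (R : realType) (X : normedModType R[i]).

Lemma unitmx_modc_gt0 k (T : 'M[R[i]]_k) : (T \in unitmx) = (0 < modc (\det T)).
Proof. by rewrite modc_gt0 -unitfE -unitmxE. Qed.

(** A basis that almost attains the infimum defining [vol x], once normalised, is
    almost an Auerbach basis: by [vol_replace] its coordinate functionals have norm
    at most 2. *)
Lemma auerbach k (x : 'I_k -> X) : 0 < vol x -> exists2 T, T \in unitmx &
  (forall j, rnorm (recomb x T j) = 1) /\ 1 / 2 <= vol (recomb x T).
Proof.
move=> x0.
have [_ [T uT <-]] := inf_adherent x0 (vol_has_inf x).
move: (uT); rewrite /= unitmx_modc_gt0 => dT; rewrite ltr_pdivrMr// -/(vol x) => Tlt.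
have := vol_recomb_le x uT; set y := recomb x T in Tlt *.
have vy : 0 < vol x * modc (\det T) by rewrite mulr_gt0.
move=> /(lt_le_trans vy) P0.
have y0 j : 0 < rnorm (y j).
  rewrite lt_neqAle rnorm_ge0 andbT; apply: contraTneq P0 => yj.
  by rewrite (bigD1 j)//= -yj mul0r ltxx.
pose S : 'M[R[i]]_k := diag_mx (\row_j ((rnorm (y j))^-1)%:C%C).
have dS : modc (\det S) = (\prod_j rnorm (y j))^-1.
  rewrite det_diag modc_prod -prodfV; apply: eq_bigr => j _.
  by rewrite mxE modc_real gtr0_norm ?invr_gt0.
have uS : S \in unitmx by rewrite unitmx_modc_gt0 dS invr_gt0.
exists (T *m S); first by rewrite unitmx_mul uT.
rewrite -recombM -/y; split=> [j|].
  rewrite /recomb /comb (bigD1 j)//= big1 ?addr0 => [|i /negPf ij].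
    by rewrite !mxE eqxx mulr1n rnormZ modc_real gtr0_norm ?invr_gt0// mulVf// gt_eqF.
  by rewrite !mxE ij mulr0n scale0r.
rewrite vol_recomb// dS vol_recomb// [leRHS]mulrC ler_pdivlMr//.
by move: Tlt; lra.
Qed.

(** Substituting a linear combination for the i-th vector multiplies the volume by
    the i-th coefficient; so a large volume bounds the coefficients. *)
Lemma vol_replace k (e : 'I_k -> X) c i :
  vol e * modc (c i) <= rnorm (comb e c) * \prod_(j | j != i) rnorm (e j).
Proof.
have [->|ci] := eqVneq (c i) 0.
  rewrite modc0 mulr0 mulr_ge0 ?rnorm_ge0// prodr_ge0// => j _.
  exact: rnorm_ge0.
pose S : 'M[R[i]]_k := \matrix_(j, l) if l == i then c j else (j == l)%:R.
have dS : \det S = c i.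
  rewrite (expand_det_row _ i) (bigD1 i)//= big1 ?addr0 => [|l /negPf li]; last first.
    by rewrite mxE li eq_sym li mul0r.
  rewrite mxE eqxx /cofactor -signr_odd addnn odd_double mul1r.
  rewrite (_ : row' i _ = 1%:M) ?det1 ?mulr1//.
  apply/matrixP => a b; rewrite !mxE [_ == i]eq_sym (negPf (neq_lift _ _)).
  by rewrite (inj_eq (@lift_inj _ i)).
have uS : S \in unitmx by rewrite unitmxE dS unitfE.
have := vol_recomb_le e uS; rewrite dS (bigD1 i)//= => /le_trans; apply.
rewrite le_eqVlt; apply/orP; left; apply/eqP; congr (rnorm _ * _).
  by rewrite /recomb /comb; apply: eq_bigr => l _; rewrite mxE eqxx.
apply: eq_bigr => j /negPf ji; congr rnorm; rewrite /recomb /comb (bigD1 j)//=.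
rewrite mxE ji eqxx scale1r big1 ?addr0// => l /negPf lj.
by rewrite mxE ji lj scale0r.
Qed.

(** An operator that shrinks one vector of the span shrinks the volume as well,
    because in an almost Auerbach basis that vector can replace the basis vector on
    which it has its largest coordinate. *)
Lemma conorm_ge k (x : 'I_k.+1 -> X) (b : bounded_op X) A y :
  0 < vol x -> (forall v, rnorm (b v) <= A * rnorm v) -> 0 <= A -> in_span x y ->
  vol (b \o x) * rnorm y <= 2 * k.+1%:R * A ^+ k * vol x * rnorm (b y).
Proof.
move=> x0 bA A0 xy; have [T uT [e1 eh]] := auerbach x0.
move: (uT); rewrite unitmx_modc_gt0 => dT.
have [c yE] := (in_span_recomb x y uT).2 xy.
set e := recomb x T in e1 eh yE.
have vbe : vol (b \o e) = modc (\det T) * vol (b \o x) by rewrite recomb_linear vol_recomb.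
have ve : vol e = modc (\det T) * vol x by rewrite vol_recomb.
have ci i : vol (b \o e) * modc (c i) <= rnorm (b y) * A ^+ k.
  apply: le_trans (vol_replace _ _ _) _; rewrite -comb_linear -yE.
  apply: ler_wpM2l; first exact: rnorm_ge0.
  have -> : A ^+ k = \prod_(j < k.+1 | j != i) A.
    by rewrite prodr_const cardC1 card_ord.
  apply: ler_prod => j _; rewrite rnorm_ge0 /=.
  by rewrite (le_trans (bA _))// e1 mulr1.
have : vol (b \o e) * rnorm y <= k.+1%:R * (rnorm (b y) * A ^+ k).
  apply: (@le_trans _ _ (\sum_i vol (b \o e) * modc (c i))).
    rewrite -mulr_sumr ler_wpM2l ?vol_ge0// yE.
    apply: le_trans (rnorm_sum_le _ _ _) _; apply: ler_sum => i _.
    by rewrite rnormZ e1 mulr1.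
  apply: le_trans (ler_sum _ (fun i _ => ci i)) _.
  by rewrite sumr_const card_ord mulr_natl.
move=> h; rewrite -(ler_pM2l dT) mulrA -vbe (le_trans h)//.
have -> : modc (\det T) * (2 * k.+1%:R * A ^+ k * vol x * rnorm (b y)) =
  (k.+1%:R * (rnorm (b y) * A ^+ k)) * (2 * vol e) by rewrite ve; ring.
rewrite ler_peMr//; last by move: eh; lra.
by rewrite mulr_ge0// mulr_ge0 ?rnorm_ge0 ?exprn_ge0.
Qed.

(** Leibniz' formula bounds the determinant of any change of basis by the product
    of the norms of the new vectors. *)
Lemma vol_ge_indep k (z : 'I_k -> X) a : 0 <= a ->
  (forall c i, a * modc (c i) <= rnorm (comb z c)) -> a ^+ k / k`!%:R <= vol z.
Proof.
move=> a0 h; apply: vol_ge => T _.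
rewrite mulrAC ler_pdivrMr ?ltr0n ?fact_gt0//.
apply: le_trans (ler_wpM2l (exprn_ge0 _ a0) (modc_sum_le _ _ _)) _.
rewrite mulr_sumr.
have -> : k`!%:R = \sum_(s : {perm 'I_k}) (1 : R) by rewrite sumr_const card_Sn.
rewrite mulr_sumr; apply: ler_sum => s _; rewrite mulr1 modcM.
rewrite (_ : modc ((-1) ^+ s) = 1); last first.
  by rewrite /modc normrX normrN1 expr1n.
rewrite mul1r modc_prod [leRHS](reindex_inj (@perm_inj _ s)) /=.
have -> : a ^+ k = \prod_(j < k) a by rewrite prodr_const card_ord.
rewrite -big_split /=; apply: ler_prod => i _.
rewrite mulr_ge0 ?modc_ge0//=; exact: (h (T^~ (s i)) i).
Qed.

Definition snoc k (x : 'I_k -> X) (u : X) : 'I_(k + 1) -> X :=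
  fun i => match fintype.split i with inl j => x j | inr _ => u end.

Lemma snoc_l k (x : 'I_k -> X) u j : snoc x u (lshift 1 j) = x j.
Proof. by rewrite /snoc (unsplitK (inl j)). Qed.

Lemma snoc_r k (x : 'I_k -> X) u j : snoc x u (rshift k j) = u.
Proof. by rewrite /snoc (unsplitK (inr j)). Qed.

Lemma snoc_image k (x : 'I_k -> X) u (b : bounded_op X) :
  snoc (b \o x) (b u) = b \o snoc x u.
Proof. by apply/funext => i; rewrite /snoc /=; case: fintype.split. Qed.

Lemma comb_snoc k (x : 'I_k -> X) u c :
  comb (snoc x u) c = comb x (c \o lshift 1) + c (rshift k ord0) *: u.
Proof.
rewrite /comb big_split_ord big_ord1 /= snoc_r; congr (_ + _).
by apply: eq_bigr => i _; rewrite snoc_l.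
Qed.

Lemma recomb_snoc k (x : 'I_k -> X) u T (d : 'cV[R[i]]_k) a :
  recomb (snoc x u) (block_mx T d 0 (a%:M : 'M[R[i]]_1)) =
  snoc (recomb x T) (comb x (d^~ ord0) + a *: u).
Proof.
apply/funext => j; rewrite /recomb comb_snoc.
rewrite -[j]splitK; case: (fintype.split j) => i /=.
  rewrite snoc_l block_mxEdl mxE scale0r addr0; congr comb.
  by apply/funext => l /=; rewrite block_mxEul.
rewrite snoc_r block_mxEdr ord1 mxE eqxx; congr (comb x _ + _).
by apply/funext => l /=; rewrite block_mxEur.
Qed.

Lemma vol_snoc_le k (x : 'I_k -> X) u : vol (snoc x u) <= vol x * rnorm u.
Proof.
have [->|u0] := eqVneq u 0.
  rewrite rnorm0 mulr0 (le_trans (vol_le _))// big_split_ord big_ord1 /=.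
  by rewrite snoc_r rnorm0 mulr0.
rewrite -ler_pdivrMr ?rnorm_gt0//; apply: vol_ge => T uT.
rewrite mulrAC ler_pdivrMr ?rnorm_gt0//.
have dU : \det (block_mx T 0 0 (1%:M : 'M[R[i]]_1)) = \det T.
  by rewrite det_ublock det1 mulr1.
have uU : block_mx T 0 0 (1%:M : 'M[R[i]]_1) \in unitmx by rewrite unitmxE dU -unitmxE.
have c0 : comb x ((0 : 'cV[R[i]]_k)^~ ord0) = 0.
  by rewrite /comb big1// => i _; rewrite mxE scale0r.
have := vol_recomb_le (snoc x u) uU.
rewrite dU recomb_snoc c0 add0r scale1r => /le_trans; apply.
rewrite big_split_ord big_ord1 /= snoc_r.
rewrite le_eqVlt; apply/orP; left; apply/eqP; congr (_ * _).
by apply: eq_bigr => i _; rewrite snoc_l.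
Qed.

(** The inverse of the bound of [vol_ge_indep] for k+1 vectors and a = 1/6. *)
Definition snoc_const k : R := 6 ^+ (k + 1) * (k + 1)`!%:R.

Lemma snoc_const_gt0 k : 0 < snoc_const k.
Proof. by rewrite mulr_gt0 ?exprn_gt0 ?ltr0n ?fact_gt0. Qed.

(** Base times height: the volume grows in proportion to the distance of the new
    vector w from the span of y.  Subtracting from w an almost nearest point of
    that span and normalising leaves, together with an almost Auerbach basis of the
    span, a tuple to which [vol_ge_indep] applies with the constant 1/6. *)
Lemma vol_snoc_ge k (y : 'I_k -> X) w r : 0 < r ->
  (forall s, in_span y s -> r <= rnorm (w - s)) ->
  vol y * r <= snoc_const k * vol (snoc y w).
Proof.
move=> r0 h; have [vy0|vy] := leP (vol y) 0.
  rewrite (@le_trans _ _ 0)// ?mulr_le0_ge0// ?(ltW r0)//.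
  by rewrite mulr_ge0 ?vol_ge0// ltW// snoc_const_gt0.
have [T uT [e1 eh]] := auerbach vy; move: (uT); rewrite unitmx_modc_gt0 => dT.
pose S := [set rnorm (w - s) | s in in_span y].
have S0 : S !=set0 by exists (rnorm (w - 0)), 0 => //; exact: in_span0.
have rS : r <= inf S by apply: lb_le_inf => // _ [s ys <-]; exact: h.
have Sl : has_lbound S by exists r => _ [s ys <-]; exact: h.
set q := inf S in rS; have q0 : 0 < q by exact: lt_le_trans rS.
have [_ [s ys <-] wsq] := inf_adherent q0 (conj S0 Sl).
have qS t : in_span y t -> q <= rnorm (w - t) by move=> yt; apply: ge_inf => //; exists t.
(* The height of w over the span of y is q; z below is w minus an almost nearest
   point, divided by q, and U is the matrix that leads from (y, w) to (e, z). *)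
have [d sE] := ys; pose qi : R[i] := (q^-1)%:C%C.
have mqi : modc qi = q^-1 by rewrite modc_real gtr0_norm ?invr_gt0.
pose U := block_mx T (\col_i (- (qi * d i))) 0 (qi%:M : 'M[R[i]]_1).
have dU : modc (\det U) = modc (\det T) / q by rewrite det_ublock det_scalar1 modcM mqi.
have uU : U \in unitmx by rewrite unitmx_modc_gt0 dU divr_gt0.
set e := recomb y T in e1 eh.
have UE : recomb (snoc y w) U = snoc e (qi *: (w - s)).
  rewrite recomb_snoc sE; congr snoc; rewrite scalerBr addrC; congr (_ + _).
  rewrite /comb scaler_sumr -sumrN; apply: eq_bigr => i _.
  by rewrite mxE scaleNr scalerA.
have low : 6^-1 ^+ (k + 1) / (k + 1)`!%:R <= vol (snoc e (qi *: (w - s))).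
  apply: vol_ge_indep => // c i; rewrite comb_snoc.
  set c' := c (rshift k ord0); set N := rnorm _.
  have N0 : modc c' <= N.
    have [->|c0] := eqVneq c' 0; first by rewrite modc0 rnorm_ge0.
    rewrite /N scalerA.
    have -> : comb e (c \o lshift 1) + (c' * qi) *: (w - s) =
        (c' * qi) *: (w - (s - (c' * qi)^-1 *: comb e (c \o lshift 1))).
      rewrite !scalerBr scalerA mulfV ?scale1r ?mulf_neq0//.
        by rewrite opprB [RHS]addrCA.
      by rewrite -modc_gt0 mqi invr_gt0.
    rewrite rnormZ modcM mqi -mulrA ler_peMr ?modc_ge0//.
    rewrite mulrC ler_pdivlMr ?mul1r//; apply: qS; apply: in_spanB => //.
    by apply: in_spanZ; apply/(in_span_recomb y _ uT); eexists.
  have N1 j : modc (c (lshift 1 j)) <= 6 * N.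
    have := vol_replace e (c \o lshift 1) j; rewrite big1 ?mulr1 /=; last first.
      by move=> l _; rewrite e1.
    have : rnorm (comb e (c \o lshift 1)) <= N + 2 * modc c'.
      have -> : comb e (c \o lshift 1) = comb e (c \o lshift 1) + c' *: (qi *: (w - s))
         - c' *: (qi *: (w - s)) by rewrite addrK.
      apply: le_trans (rnormB_le _ _) _; rewrite lerD2l !rnormZ mulrC ler_wpM2r ?modc_ge0//.
      rewrite mqi mulrC ler_pdivrMr//; move: wsq; rewrite -/q; lra.
    move=> le1 le2; have le3 := ler_wpM2r (modc_ge0 (c (lshift 1 j))) eh.
    by move: (le_trans le3 (le_trans le2 le1)) N0; lra.
  rewrite ler_pdivrMl//; rewrite -(splitK i); case: (fintype.split i) => j /=; first exact: N1.
  by rewrite ord1 (le_trans N0)// ler_peMl// ?rnorm_ge0// ler1n.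
move: low; rewrite -UE vol_recomb// dU exprVn -invfM -/(snoc_const k).
rewrite -(ler_pM2l (snoc_const_gt0 k)) mulfV ?gt_eqF ?snoc_const_gt0// => low.
have vy1 : vol y * modc (\det T) <= 1.
  by apply: le_trans (vol_recomb_le _ uT) _; rewrite big1.
rewrite -(ler_pM2l dT) mulrA; apply: (@le_trans _ _ r).
  by rewrite ler_piMl ?(ltW r0)// mulrC.
apply: le_trans rS _; rewrite -(ler_pM2r (_ : 0 < q^-1)) ?invr_gt0// mulfV ?gt_eqF//.
by apply: le_trans low _; rewrite le_eqVlt; apply/orP; left; apply/eqP; ring.
Qed.

(** If b contracts (k+1)-volumes by kap but keeps the volume of x, it must contract
    the height of a vector over the span of x: b induces a small operator from
    X / span x to X / span (b x). *)
Lemma quotient_contraction k (x : 'I_k -> X) (b : bounded_op X) kap v x0 r :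
  0 < vol x -> 0 < vol (b \o x) -> 0 < kap -> 0 < r ->
  (forall z : 'I_(k + 1) -> X, vol (b \o z) <= kap * vol z) ->
  in_span x x0 -> rnorm (v - x0) <= r ->
  exists2 x1, in_span x x1 &
    rnorm (b v - b x1) <= 2 * snoc_const k * kap * r * vol x / vol (b \o x).
Proof.
move=> vx vbx kap0 r0 bk xx0 vr.
pose rho := 2 * snoc_const k * kap * r * vol x / vol (b \o x); rewrite -/rho.
have rho0 : 0 < rho by rewrite !(mulr_gt0,invr_gt0)// snoc_const_gt0.
apply: contrapT => /forall2NP h.
have := @vol_snoc_ge k (b \o x) (b (v - x0)) rho rho0.
have -> : vol (b \o x) * rho = 2 * (snoc_const k * (kap * (vol x * r))).
  by rewrite /rho; field; rewrite gt_eqF.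
have hyp s : in_span (b \o x) s -> rho <= rnorm (b (v - x0) - s).
  move=> /in_span_imageP[u xu ->].
  have [|/negP] := h (x0 + u); first by move=> []; exact: in_spanD.
  by rewrite -ltNge !linearB linearD /= opprD addrA => /ltW.
move=> /(_ hyp); rewrite snoc_image => /le_trans/(_ (ler_wpM2l (ltW (snoc_const_gt0 k)) (bk _))).
apply/negP; rewrite -ltNge [ltRHS]mulrCA ltr_pM2l ?snoc_const_gt0//.
have le1 : kap * vol (snoc x (v - x0)) <= kap * (vol x * r).
  by rewrite ler_pM2l// (le_trans (vol_snoc_le _ _))// ler_pM2l.
by rewrite (le_lt_trans le1)// mulr_natl mulr2n ltrDl !mulr_gt0.
Qed.

End Auerbach.

(** * Geometric and submultiplicative growth *)

Section RealAux.
Context (R : realType).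

Lemma geometric_small (a x e : R) : 0 <= x -> x < 1 -> 0 < e ->
  exists n0, forall n, (n0 <= n)%N -> a * x ^+ n < e.
Proof.
move=> x0 x1 e0; have := @cvg_geometric R a x.
rewrite ger0_norm// => /(_ x1)/cvgrPdist_lt/(_ e e0)[n0 _ h].
exists n0 => n nn0; have := h n nn0; rewrite /= sub0r normrN.
exact/le_lt_trans/ler_norm.
Qed.

Lemma geometric_large (C y : R) : 1 < y -> exists n0, forall n, (n0 <= n)%N -> C < y ^+ n.
Proof.
move=> y1; have y0 : 0 < y by lra.
have yi : 0 <= y^-1 by rewrite invr_ge0 ltW.
have yi1 : y^-1 < 1 by rewrite invf_lt1.
have [n0 h] := geometric_small C yi yi1 ltr01.
exists n0 => n /h; rewrite exprVn ltr_pdivrMr ?exprn_gt0// mul1r; exact.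
Qed.

Lemma bernoulli_ge (x : R) n : 0 <= x <= 1 -> 1 - n%:R * x <= (1 - x) ^+ n.
Proof.
move=> x01; elim: n => [|n IH]; first by rewrite mul0r subr0 expr0.
rewrite exprS -natr1.
have : 0 <= n%:R :> R by [].
have : (1 - x) * (1 - n%:R * x) <= (1 - x) * (1 - x) ^+ n by rewrite ler_wpM2l//; lra.
move: x01 => /andP[]; move: ((1 - x) ^+ n) (n%:R) => p m; nra.
Qed.

(** Witness: e = (1 - 1/y)/p, since (1 + e)^p (1 - e)^p <= 1 and
    (1 - e)^p >= 1 - p e = 1/y. *)
Lemma small_root (y : R) p : 1 < y -> exists2 e, 0 < e & (1 + e) ^+ p <= y.
Proof.
move=> y1; have y0 : 0 < y by lra.
case: p => [|p]; first by exists 1 => //; rewrite expr0 ltW.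
have yi : 0 < y^-1 < 1 by rewrite invr_gt0 y0 invf_lt1.
have p1 : 1 <= p.+1%:R :> R by rewrite ler1n.
exists ((1 - y^-1) / p.+1%:R); first by rewrite divr_gt0//; lra.
set e := _ / _.
have pe : p.+1%:R * e = 1 - y^-1 by rewrite /e mulrC divfK// gt_eqF.
have e01 : 0 <= e <= 1.
  apply/andP; split; first by rewrite divr_ge0//; lra.
  by rewrite ler_pdivrMr ?mul1r//; lra.
have := @bernoulli_ge e p.+1 e01; rewrite pe.
have -> : 1 - (1 - y^-1) = y^-1 by lra.
move=> h.
have h2 : (1 + e) ^+ p.+1 * (1 - e) ^+ p.+1 <= 1.
  by rewrite -exprMn exprn_ile1//; nra.
rewrite -[leRHS]mul1r -ler_pdivrMr// (le_trans _ h2)//.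
by rewrite ler_wpM2l// exprn_ge0//; lra.
Qed.

(** Fekete's argument for a family of upper bounds: a bound s^p at a single
    exponent p propagates to all exponents by division with remainder by p.  Stated
    for predicates so that it applies to norms and to volumes alike. *)
Lemma submul_growth (P : nat -> R -> Prop) :
  (forall n c c', c <= c' -> P n c -> P n c') ->
  (forall m n c d, 0 <= c -> 0 <= d -> P m c -> P n d -> P (m + n)%N (c * d)) ->
  P 0 1 -> (exists c, P 1%N c) ->
  forall p s, (0 < p)%N -> 0 < s -> P p (s ^+ p) ->
  exists2 C, 0 < C & forall n, P n (C * s ^+ n).
Proof.
move=> Pmono Pmul P0 [c P1] p s p0 s0 Pp.
pose K := Num.max 1 (c / s).
have K1 : 1 <= K by rewrite le_max lexx.
have K0 : 0 < K by lra.
have {}P1 : P 1%N (K * s).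
  by apply: Pmono P1; rewrite -ler_pdivrMr// le_max lexx orbT.
have Pr r : P r ((K * s) ^+ r).
  elim: r => [|r IH]; first by rewrite expr0.
  by rewrite exprS -addn1 addnC; apply: Pmul => //; rewrite ?exprn_ge0// ltW// mulr_gt0.
have Pq q : P (p * q)%N (s ^+ (p * q)).
  elim: q => [|q IH]; first by rewrite muln0 expr0.
  by rewrite mulnS exprD; apply: Pmul; rewrite ?exprn_ge0// ltW.
exists (K ^+ p); first exact: exprn_gt0.
move=> n; rewrite {1 2}(divn_eq n p) mulnC.
apply: Pmono (Pmul _ _ _ _ _ _ (Pq (n %/ p)%N) (Pr (n %% p)%N)); last 2 first.
- by rewrite exprn_ge0// ltW.
- by rewrite exprn_ge0// mulr_ge0// ltW.
rewrite exprMn mulrCA -exprD ler_pM2r ?exprn_gt0//.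
by rewrite ler_weXn2l// ltnW// ltn_mod.
Qed.

End RealAux.

(** * Powers of a set of operators *)

Section OperatorSets.
Context (R : realType) (X : normedModType R[i]).
Implicit Types (M N : set (bounded_op X)).

Lemma op_comp1 (b : bounded_op X) : op_comp b (op_id X) = b.
Proof. exact/val_inj. Qed.

Lemma op_1comp (b : bounded_op X) : op_comp (op_id X) b = b.
Proof. exact/val_inj. Qed.

Lemma op_compA (a b c : bounded_op X) : op_comp a (op_comp b c) = op_comp (op_comp a b) c.
Proof. exact/val_inj. Qed.

Lemma opset_expS M n : opset_exp M n.+1 = opset_mul M (opset_exp M n).
Proof. by []. Qed.

Lemma opset_exp1 M : opset_exp M 1 = M.
Proof.
apply/seteqP; split=> [_ [a Ma [_ -> <-]]|a Ma]; first by rewrite op_comp1.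
by exists a => //; exists (op_id X) => //; rewrite op_comp1.
Qed.

Lemma opset_expD M m n : opset_exp M (m + n) = opset_mul (opset_exp M m) (opset_exp M n).
Proof.
elim: m => [|m IH].
  apply/seteqP; split=> [b Mb|_ [_ -> [b Mb <-]]]; last by rewrite op_1comp.
  by exists (op_id X) => //; exists b => //; rewrite op_1comp.
rewrite addSn !opset_expS IH; apply/seteqP; split.
  move=> _ [a Ma [_ [b Mb [c Mc <-]] <-]].
  by exists (op_comp a b); [exists a => //; exists b|exists c => //; rewrite op_compA].
move=> _ [_ [a Ma [b Mb <-]] [c Mc <-]].
by exists a => //; exists (op_comp b c); [exists b => //; exists c|rewrite op_compA].
Qed.

Lemma opset_exp_comp M m n b c : opset_exp M m b -> opset_exp M n c ->
  opset_exp M (m + n) (op_comp b c).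
Proof. by move=> Mb Mc; rewrite opset_expD; exists b => //; exists c. Qed.

Lemma opset_expM M m n : opset_exp (opset_exp M m) n = opset_exp M (m * n).
Proof.
elim: n => [|n IH]; first by rewrite muln0.
by rewrite mulnS opset_expD opset_expS IH.
Qed.

Definition op_pow (b : bounded_op X) p : bounded_op X := iter p (op_comp b) (op_id X).

Lemma opset_exp_set1 b p : opset_exp [set b] p = [set op_pow b p].
Proof.
elim: p => [//|p IH]; rewrite opset_expS IH; apply/seteqP; split.
  by move=> _ [_ -> [_ -> <-]].
by move=> _ ->; exists b => //; exists (op_pow b p).
Qed.

Lemma opset_exp_pow M n b p : opset_exp M n b -> opset_exp M (n * p) (op_pow b p).
Proof.
move=> Mb; elim: p => [|p IH]; first by rewrite muln0.
by rewrite mulnS; apply: opset_exp_comp.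
Qed.

Definition exp_bounded M n c := forall b, opset_exp M n b -> opnorm b <= c.

Definition op_bounded M := exists c, exp_bounded M 1 c.

Lemma exp_bounded_growth M p s : op_bounded M -> (0 < p)%N -> 0 < s ->
  exp_bounded M p (s ^+ p) -> exists2 C, 0 < C & forall n, exp_bounded M n (C * s ^+ n).
Proof.
move=> M1; apply: submul_growth => //.
- by move=> n c c' cc' h b /h bc; rewrite (le_trans bc).
- move=> m n c d c0 d0 hc hd b; rewrite opset_expD => -[b1 /hc h1 [b2 /hd h2 <-]].
  by rewrite (le_trans (opnorm_comp _ _))// ler_pM// opnorm_ge0.
- by move=> _ ->; apply: opnorm_leP => // v; rewrite mul1r.
Qed.

Definition vol_bounded M k n c :=
  forall b (x : 'I_k -> X), opset_exp M n b -> vol (b \o x) <= c * vol x.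

Definition vol_contracting M k := exists n c, [/\ (0 < n)%N, c < 1 & vol_bounded M k n c].

Lemma vol_bounded_growth M k : op_bounded M -> vol_contracting M k ->
  exists C c, [/\ 0 < C, 0 < c < 1 & forall n, vol_bounded M k n (C * c ^+ n)].
Proof.
move=> [c1 M1] [p [c [p0 c_lt1 hc]]].
pose c' := Num.max c (1 / 2).
have c'1 : 1 / 2 <= c' < 1 by rewrite le_max lexx orbT gt_max c_lt1; lra.
have p1 : 1 <= p%:R :> R by rewrite ler1n.
pose e := (1 - c') / p%:R.
have pe : p%:R * e = 1 - c' by rewrite /e mulrC divfK// gt_eqF//; lra.
have e0 : 0 < e by rewrite divr_gt0//; lra.
have e1 : e <= 1 / 2 by nra.
have s01 : 0 < 1 - e < 1 by lra.
have [n x y xy h b z /h bz|m n x y x0 y0 hx hy b z|b z ->|||C C0 hC] :=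
    @submul_growth R (vol_bounded M k) _ _ _ _ p (1 - e) p0 (proj1 (andP s01)).
- by rewrite (le_trans (bz _))// ler_wpM2r ?vol_ge0.
- rewrite opset_expD => -[b1 Mb1 [b2 Mb2 <-]].
  rewrite (le_trans (hx _ (b2 \o z) Mb1))// -mulrA ler_wpM2l//; exact: hy.
- by rewrite mul1r.
- exists (Num.max 0 c1 ^+ k) => b z Mb; apply: vol_image_le => [v|]; last by rewrite le_max lexx.
  apply: le_trans (opnormP _ _) _; rewrite ler_wpM2r ?rnorm_ge0//.
  by rewrite (le_trans (M1 _ Mb))// le_max lexx orbT.
- move=> b z Mb; apply: le_trans (hc _ _ Mb) _; rewrite ler_wpM2r ?vol_ge0//.
  have := @bernoulli_ge R e p; rewrite pe; have -> : 1 - (1 - c') = c' by lra.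
  have -> : 0 <= e <= 1 by lra.
  move=> /(_ isT); apply: le_trans; by rewrite le_max lexx.
- by exists C, (1 - e).
Qed.

End OperatorSets.

(** * Volumes of large dimension contract *)

Section Packing.
Context (R : realType) (X : normedModType R[i]).
Implicit Types (M N : set (bounded_op X)).

Definition ball_cover N (F : seq X) (t : R) :=
  forall a u, N a -> rnorm u <= 1 -> exists2 c, c \in F & rnorm (a u - c) <= t.

(** The index of a ball records the element of F that is used at each of the s
    factors.  The centres depend on b, but their number does not. *)
Lemma ball_cover_exp N F t : 0 < t -> ball_cover N F t ->
  forall s b, opset_exp N s b -> exists g : s.-tuple 'I_(size F) -> X,
  forall y, rnorm y <= 1 -> exists p, rnorm (b y - g p) <= t ^+ s.
Proof.
move=> t0 NF; elim=> [|s IH] b.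
  by move=> ->; exists (fun=> 0) => y y1; exists [tuple]; rewrite subr0.
rewrite opset_expS => -[a Na [b' /IH[g hg] <-]].
exists (fun p : s.+1.-tuple _ =>
  a (g [tuple of behead p]) + (t ^+ s)%:C%C *: nth 0 F (thead p)) => y y1.
have [p yp] := hg y y1.
have ts : 0 < t ^+ s by rewrite exprn_gt0.
pose z := (t ^+ s)^-1%:C%C *: (b' y - g p).
have [|c cF zc] := NF a z Na.
  by rewrite rnormZ modc_real gtr0_norm ?invr_gt0// ler_pdivrMl// mulr1.
have iF : (index c F < size F)%N by rewrite index_mem.
exists [tuple of Ordinal iF :: p].
have pE : [tuple of behead [tuple of Ordinal iF :: p]] = p by exact/val_inj.
rewrite theadE /= nth_index// pE.
have bE : b' y = g p + (t ^+ s)%:C%C *: z.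
  rewrite scalerA -rmorphM mulfV ?gt_eqF// rmorph1 scale1r.
  by rewrite addrC subrK.
rewrite bE linearD linearZ /= opprD addrACA subrr add0r -scalerBr rnormZ.
by rewrite modc_real gtr0_norm// exprSr ler_wpM2l// ltW.
Qed.

(** In an almost Auerbach basis, the n^(k+1) points of a lattice of mesh about 1/n
    have images under b that are too far apart to share a ball of radius t^s. *)
Lemma packing N F t s b k (x : 'I_k.+1 -> X) A n :
  0 < t -> ball_cover N F t -> opset_exp N s b -> opnorm b <= A ->
  0 < vol x -> 1 / 2 * vol x <= vol (b \o x) -> (0 < n)%N ->
  16 * n%:R * k.+1%:R ^+ 2 * A ^+ k * t ^+ s < 1 ->
  (n ^ k.+1 <= size F ^ s)%N.
Proof.
move=> t0 NF Nb bA x0 bx n0 small.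
have A0 : 0 <= A := le_trans (opnorm_ge0 b) bA.
have bA' v : rnorm (b v) <= A * rnorm v.
  by apply: le_trans (opnormP _ _) _; rewrite ler_wpM2r// rnorm_ge0.
have [g hg] := ball_cover_exp t0 NF Nb.
have [T uT [e1 eh]] := auerbach x0; set e := recomb x T in e1 eh.
have n0' : 0 < n%:R :> R by rewrite ltr0n.
have k0 : 0 < k.+1%:R :> R by rewrite ltr0n.
(* The mesh w keeps the n^(k+1) lattice points inside the unit ball. *)
pose w : R := (n%:R * k.+1%:R)^-1.
have w0 : 0 < w by rewrite invr_gt0 mulr_gt0.
pose y (f : {ffun 'I_k.+1 -> 'I_n}) : X := comb e (fun i => ((f i)%:R * w)%:C%C).
have y1 f : rnorm (y f) <= 1.
  apply: le_trans (rnorm_sum_le _ _ _) _.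
  apply: (@le_trans _ _ (\sum_(i < k.+1) n%:R * w)).
    apply: ler_sum => i _; rewrite rnormZ e1 mulr1 modc_real ger0_norm.
      by rewrite ler_pM2r// ler_nat ltnW.
    by rewrite mulr_ge0// ltW.
  rewrite sumr_const card_ord -[leLHS]mulr_natr /w.
  by rewrite mulrAC mulfV// gt_eqF// mulr_gt0.
have sep f h : f != h -> w <= 2 * rnorm (y f - y h).
  move=> fh; have [i fhi] : exists i, f i != h i.
    apply: contrapT => /forallNP fhe; move/eqP: fh; apply; apply/ffunP => i.
    by apply/eqP; move/negP: (fhe i); rewrite negbK.
  have -> : y f - y h = comb e (fun i => (((f i)%:R - (h i)%:R) * w)%:C%C).
    rewrite /y /comb -sumrB; apply: eq_bigr => j _.
    by rewrite -scalerBl -rmorphB -mulrBl.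
  have := vol_replace e (fun i => (((f i)%:R - (h i)%:R) * w)%:C%C) i.
  rewrite big1 ?mulr1 => [|j _]; last by rewrite e1.
  rewrite modc_real normrM (gtr0_norm w0).
  have d1 : 1 <= `|(f i)%:R - (h i)%:R| :> R.
    have [lt|lt|/val_inj eq] := ltngtP (f i) (h i); last by rewrite eq eqxx in fhi.
      by rewrite distrC -natrB ?(ltnW lt)// ger0_norm// ler1n subn_gt0.
    by rewrite -natrB ?(ltnW lt)// ger0_norm// ler1n subn_gt0.
  move=> le1.
  have : w <= `|(f i)%:R - (h i)%:R| * w by rewrite ler_peMl// ltW.
  have := ler_wpM2r (_ : 0 <= `|(f i)%:R - (h i)%:R| * w) eh.
  rewrite mulr_ge0 ?(ltW w0)// => /(_ isT) le2 le3.
  by move: (le_trans le2 le1); lra.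
pose code f := sval (cid (hg (y f) (y1 f))).
have codeP f : rnorm (b (y f) - g (code f)) <= t ^+ s := svalP (cid (hg (y f) (y1 f))).
have inj : injective code.
  move=> f h fh; apply/eqP; apply/negPn/negP => /sep; apply/negP; rewrite -ltNge.
  have close : rnorm (b (y f - y h)) <= 2 * t ^+ s.
    rewrite linearB; apply: le_trans (rnorm_triangle (g (code f)) _ _) _.
    have -> : 2 * t ^+ s = t ^+ s + t ^+ s by ring.
    by apply: lerD; [exact: codeP|rewrite fh rnormB_sym; exact: codeP].
  have ysp : in_span x (y f - y h).
    by apply/(in_span_recomb x _ uT); apply: in_spanB; eexists.
  have := conorm_ge x0 bA' A0 ysp.
  have Ak : 0 <= A ^+ k by rewrite exprn_ge0.
  move=> le1.
  have le2 : rnorm (y f - y h) <= 4 * k.+1%:R * A ^+ k * rnorm (b (y f - y h)).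
    rewrite -(ler_pM2l x0).
    have -> : vol x * (4 * k.+1%:R * A ^+ k * rnorm (b (y f - y h))) =
      2 * (2 * k.+1%:R * A ^+ k * vol x * rnorm (b (y f - y h))) by ring.
    have := le_trans (ler_wpM2r (rnorm_ge0 (y f - y h)) bx) le1.
    by rewrite -mulrA; lra.
  have le3 : rnorm (y f - y h) <= 8 * k.+1%:R * A ^+ k * t ^+ s.
    apply: le_trans le2 _.
    have -> : 8 * k.+1%:R * A ^+ k * t ^+ s = 4 * k.+1%:R * A ^+ k * (2 * t ^+ s) by ring.
    by rewrite ler_wpM2l// mulr_ge0// mulr_ge0// ltW.
  rewrite /w -[ltRHS]mul1r ltr_pdivlMr ?mulr_gt0//.
  apply: le_lt_trans small.
  have -> : 16 * n%:R * k.+1%:R ^+ 2 * A ^+ k * t ^+ s =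
    2 * (8 * k.+1%:R * A ^+ k * t ^+ s) * (n%:R * k.+1%:R) :> R by ring.
  by rewrite ler_pM2r ?mulr_gt0// ler_pM2l.
have := leq_card code inj.
by rewrite card_ffun !card_ord card_tuple card_ord.
Qed.
End Packing.

Section LargeDimension.
Context (R : realType) (X : normedModType R[i]).
Implicit Types (M N : set (bounded_op X)).

(** For a bounded M this means that its joint spectral radius is at most 1. *)
Definition subexp_growth M :=
  forall e, 0 < e -> exists2 C, 0 < C & forall n, exp_bounded M n (C * (1 + e) ^+ n).

Lemma not_vol_contracting M k n c : (0 < n)%N -> c < 1 -> 0 <= c ->
  ~ vol_contracting M k ->
  exists b x, [/\ opset_exp M n b, 0 < vol (x : 'I_k -> X) & c * vol x <= vol (b \o x)].
Proof.
move=> n0 c1 c0 Mk; apply: contrapT => h; apply: Mk; exists n, c; split=> // b x Mb.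
have [x0|x0] := eqVneq (vol x) 0.
  have := @vol_image_le _ _ _ x b (opnorm b) (opnormP b) (opnorm_ge0 b).
  by rewrite x0 !mulr0.
rewrite leNgt; apply/negP => /ltW cb; apply: h; exists b, x; split=> //.
by rewrite lt_neqAle eq_sym x0 vol_ge0.
Qed.

(** If (k+1)-volumes were not contracted, [packing] for a product of m factors, with
    n about t^(-m/2), would give t^(-m(k+1)/2) <= (size F)^m; this fails as soon as
    t^((k+1)/2) * size F < 1. *)
Lemma vol_contracting_large M q F t : (0 < q)%N -> 0 < t < 1 ->
  ball_cover (opset_exp M q) F t -> subexp_growth M ->
  exists k, vol_contracting M k.+1.
Proof.
move=> q0 /andP[t0 t1] MF Mg.
(* With s^2 = t, half of the decay t^m is spent on making n large and the other
   half on the smallness required by packing. *)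
pose s := Num.sqrt t.
have s0 : 0 < s by rewrite sqrtr_gt0.
have s1 : s < 1 by rewrite -sqrtr1 ltr_sqrt.
have ss : t = s ^+ 2 by rewrite sqr_sqrtr// ltW.
have [k hk] := @geometric_small _ (size F)%:R s 1 (ltW s0) s1 ltr01.
exists k; apply: contrapT => nMk.
have Ps : (size F)%:R * s ^+ k.+1 < 1 by apply: hk.
(* Any y with 1 < y < 1/s would do: A^k grows at most like y^m. *)
pose y := (1 + s^-1) / 2.
have si : 1 < s^-1 by rewrite invf_gt1.
have [|e e0 ey] := @small_root _ y (q * k); first by rewrite /y; lra.
have ys : 0 <= y * s < 1.
  have -> : y * s = (1 + s) / 2 by rewrite /y; field; rewrite gt_eqF.
  by lra.
have [C C0 hC] := Mg e e0.
have /andP[ys0 ys1] := ys.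
have [j hj] := geometric_small (32 * k.+1%:R ^+ 2 * C ^+ k) ys0 ys1 ltr01.
have {}hj := hj j.+1 (leqnSn _); set m := j.+1 in hj.
have qm0 : (0 < q * m)%N by rewrite muln_gt0 q0.
have h1 : 1 / 2 < 1 :> R by lra.
have h2 : 0 <= 1 / 2 :> R by lra.
have [b [x [Mb x0 bx]]] := not_vol_contracting qm0 h1 h2 nMk.
pose u : R := s ^- m.
have u1 : 1 <= u by rewrite /u -exprVn exprn_ege1// ltW.
pose n := (Num.trunc u).+1.
have /andP[nu un] := truncn_itv (le_trans ler01 u1).
have {}nu : n%:R <= 2 * u by rewrite /n -natr1; lra.
rewrite -/n in un.
have sm : 0 < s ^+ m by rewrite exprn_gt0.
have := @packing _ _ _ F t m b k x (C * (1 + e) ^+ (q * m)) n t0 MF.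
rewrite opset_expM => /(_ Mb (hC _ _ Mb) x0 bx erefl) pk.
have /pk le1 : 16 * n%:R * k.+1%:R ^+ 2 * (C * (1 + e) ^+ (q * m)) ^+ k * t ^+ m < 1.
  apply: le_lt_trans hj.
  have -> : 32 * k.+1%:R ^+ 2 * C ^+ k * (y * s) ^+ m =
     16 * (2 * u) * k.+1%:R ^+ 2 * (C ^+ k * y ^+ m) * t ^+ m.
    rewrite ss -exprM mulnC exprM exprMn /u; field.
    by rewrite expf_neq0// gt_eqF.
  rewrite ler_pM2r ?exprn_gt0// exprMn; apply: ler_pM => //.
  - by apply: mulr_ge0; apply: exprn_ge0; [lra|apply: exprn_ge0; lra].
  - by rewrite ler_pM2r ?exprn_gt0 ?ltr0n// ler_pM2l.
  - rewrite ler_pM2l ?exprn_gt0// -exprM -mulnA [(m * k)%N]mulnC mulnA exprM.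
    by rewrite lerXn2r ?nnegrE ?exprn_ge0 ?(addr_ge0 ler01 (ltW e0))// /y; lra.
have : ((size F)%:R * s ^+ k.+1) ^+ m < 1 by rewrite exprn_ilt1// mulr_ge0// exprn_ge0// ltW.
apply/negP; rewrite -leNgt exprMn -exprM mulnC exprM -natrX.
apply: le_trans (ler_wpM2r _ (_ : (n ^ k.+1)%:R <= _)); rewrite ?ler_nat//; last first.
  by rewrite exprn_ge0// ltW.
rewrite natrX -exprMn exprn_ege1// -ler_pdivrMr// mul1r; exact: ltW.
Qed.

End LargeDimension.

(** * Record minima of a decreasing sequence *)

Section Records.
Context (R : realType).

Definition record_min (h : nat -> R) j := [forall t : 'I_j, h j <= h t].

Lemma record_minP (h : nat -> R) j :
  reflect (forall t, (t < j)%N -> h j <= h t) (record_min h j).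
Proof.
apply: (iffP forallP) => [H t tj|H t]; first exact: (H (Ordinal tj)).
exact: H.
Qed.

(** A sequence with steps at least -5/4 that falls by almost n within n steps has
    average slope -1.  If it had few pairs of consecutive records, then of any two
    consecutive steps essentially only one would lower the minimum, which would
    fall with slope at least -5/8. *)
Lemma many_records (h : nat -> R) n P :
  (forall t, (t < n)%N -> h t - 5 / 4 <= h t.+1) ->
  h n <= h 0%N + 1 - n%:R -> (10 * P.+1 <= n)%N ->
  (P < count (fun j => record_min h j && record_min h j.+1) (iota 0 n))%N.
Proof.
move=> hstep hn nP.
pose G t := count (fun j => record_min h j && record_min h j.+1) (iota 0 t).
(* Phi t bounds the running minimum of h from below.  It falls by 5/8 at every step
   and by 5/4 more for each pair of consecutive records; the last term lets an
   isolated record fall by the full 5/4 and takes the excess back at the next step. *)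
pose Phi t : R := h 0%N - 5 / 4 * (G t)%:R - 5 / 8 * t%:R - 5 / 8 * (record_min h t)%:R.
have GS t : G t.+1 = (G t + (record_min h t && record_min h t.+1))%N.
  have iE : iota 0 t.+1 = iota 0 t ++ [:: t] by rewrite -addn1 iotaD.
  by rewrite /G iE count_cat /= addn0.
have claim t : (t <= n)%N -> forall s, (s <= t)%N -> Phi t <= h s.
  elim: t => [_ s|t IH tn s].
    by rewrite leqn0 => /eqP ->; rewrite /Phi /G /=; case: record_min; rewrite /=; lra.
  have {}IH := IH (ltnW tn).
  have mono : Phi t.+1 <= Phi t.
    rewrite /Phi GS natrD -[t.+1%:R]natr1.
    by case: (record_min h t); case: (record_min h t.+1) => /=; lra.
  rewrite leq_eqVlt ltnS => /orP[/eqP ->|/IH]; last exact: le_trans.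
  have [rt|/record_minP nrt] := boolP (record_min h t.+1).
    have := hstep t tn; have := IH t (leqnn _).
    by rewrite /Phi GS natrD -[t.+1%:R]natr1 rt; case: (record_min h t) => /=; lra.
  have [s' [s't lt]] : exists s', (s' <= t)%N /\ h s' < h t.+1.
    apply: contrapT => /forallNP H; apply: nrt => s' s't.
    by rewrite leNgt; apply/negP => lt; apply: (H s').
  by rewrite (le_trans mono)// (le_trans (IH s' s't))// ltW.
have := claim n (leqnn _) n (leqnn _); rewrite /Phi -/(G n) ltnNge => cl.
apply/negP => GP.
have : (G n)%:R <= P%:R :> R by rewrite ler_nat.
have : (10 * P.+1)%:R <= n%:R :> R by rewrite ler_nat.
rewrite natrM -[P.+1%:R]natr1; have : 0 <= P%:R :> R by [].
by move: cl hn; case: (record_min h n) => /=; lra.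
Qed.

End Records.

(** * Words in a set of operators *)

Section Words.
Context (R : realType) (X : normedModType R[i]).
Implicit Types (M N : set (bounded_op X)).

Fixpoint word (a : nat -> bounded_op X) i l : bounded_op X :=
  if l is l'.+1 then op_comp (a i) (word a i.+1 l') else op_id X.

Lemma wordS a i l v : word a i l.+1 v = a i (word a i.+1 l v).
Proof. by []. Qed.

Lemma word_exp N a i l : (forall t, (i <= t < i + l)%N -> N (a t)) ->
  opset_exp N l (word a i l).
Proof.
elim: l i => [|l IH] i h //=.
exists (a i); first by apply: h; rewrite leqnn addnS ltnS leq_addr.
exists (word a i.+1 l) => //; apply: IH => t /andP[it tl].
by apply: h; rewrite (ltnW it) addnS -addSn.
Qed.

Lemma exp_word N n b : opset_exp N n b ->
  exists2 a, (forall t, (t < n)%N -> N (a t)) & b = word a 0 n.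
Proof.
suff : forall i, opset_exp N n b ->
   exists2 a, (forall t, (i <= t < i + n)%N -> N (a t)) & b = word a i n.
  by move=> /(_ 0%N).
elim: n b => [|n IH] b i.
  by move=> ->; exists (fun=> op_id X) => // t; rewrite addn0; case: leqP.
move=> [a0 Na0 [b' /(IH _ i.+1)[a Na ->] <-]].
exists (fun t => if t == i then a0 else a t).
  move=> t; have [->//|ti] := eqVneq t i.
  move=> /andP[it tn]; apply: Na; rewrite ltn_neqAle eq_sym ti it /=.
  by rewrite addSnnS.
rewrite /= eqxx; congr op_comp.
have wE j : (i < j)%N -> word a j n = word (fun t => if t == i then a0 else a t) j n.
  elim: n j {IH Na} => //= n IH j ij.
  by rewrite gtn_eqF// (IH j.+1)// ltnW.
exact: wE.
Qed.

End Words.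

(** * An invariant cone *)

Lemma cone_arith (R : realType) (a e c r : R) n :
  e ^+ n.+1 * (2 * (a * (c ^+ n * r))) = 2 * (a * e) * r * (e * c) ^+ n.
Proof. by rewrite exprMn exprS; ring. Qed.

Section Cone.
Context (R : realType) (X : normedModType R[i]).
(* E_t is the span of y_t, the image of the last tuple under the word from time t on;
   B is the loss of volume per factor that a good time tolerates. *)
Variables (k n : nat) (A B kap : R) (a : nat -> bounded_op X) (y : nat -> 'I_k.+1 -> X).
Hypothesis A1 : 1 <= A.
Hypothesis B1 : 1 <= B.
Hypothesis kap0 : 0 < kap.
Hypothesis aA : forall t, (t < n)%N -> opnorm (a t) <= A.
Hypothesis avol : forall t, (t < n)%N ->
  forall z : 'I_(k.+1 + 1) -> X, vol (a t \o z) <= kap * vol z.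
Hypothesis yE : forall t, (t < n)%N -> y t = a t \o y t.+1.
Hypothesis y0 : forall t, (t <= n)%N -> 0 < vol (y t).

Let A0 : 0 < A. Proof. exact: lt_le_trans A1. Qed.
Let B0 : 0 < B. Proof. exact: lt_le_trans B1. Qed.

Definition expansion_const : R := 2 * k.+1%:R * A ^+ k * B.
Definition contraction_const : R := 2 * snoc_const R k.+1 * kap * B.
Let E := expansion_const.
Let L := contraction_const.

Lemma expansion_const_ge1 : 1 <= E.
Proof.
rewrite /E /expansion_const mulr_ege1// mulr_ege1 ?exprn_ege1//.
have : 1 <= k.+1%:R :> R by rewrite ler1n.
lra.
Qed.

Lemma contraction_const_gt0 : 0 < L.
Proof. by rewrite !mulr_gt0// snoc_const_gt0. Qed.

Let E1 := expansion_const_ge1.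
Let E0 : 0 < E. Proof. exact: lt_le_trans E1. Qed.
Let L0 := contraction_const_gt0.

Lemma word_image l t : (t + l <= n)%N -> y t = word a t l \o y (t + l).
Proof.
elim: l t => [|l IH] t tl; first by rewrite addn0.
have tn : (t < n)%N by apply: leq_trans tl; rewrite addnS ltnS leq_addr.
by rewrite yE// (IH t.+1) ?addSnnS.
Qed.

Lemma opnorm_word l t : (t + l <= n)%N -> opnorm (word a t l) <= A ^+ l.
Proof.
elim: l t => [|l IH] t tl; first by apply: opnorm_leP => // v; rewrite mul1r.
have tn : (t < n)%N by apply: leq_trans tl; rewrite addnS ltnS leq_addr.
rewrite (le_trans (opnorm_comp _ _))// exprS ler_pM ?opnorm_ge0 ?aA//.
by apply: IH; rewrite addSnnS.
Qed.

Lemma vol_word l t (z : 'I_(k.+1 + 1) -> X) : (t + l <= n)%N ->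
  vol (word a t l \o z) <= kap ^+ l * vol z.
Proof.
elim: l t => [|l IH] t tl; first by rewrite mul1r.
have tn : (t < n)%N by apply: leq_trans tl; rewrite addnS ltnS leq_addr.
apply: le_trans (avol tn (word a t.+1 l \o z)) _.
by rewrite exprS -mulrA ler_pM2l// IH// addSnnS.
Qed.

(** The lower bound for products of length l at times where the volume did not drop
    faster than B^(-l); the constants of [conorm_ge] are absorbed into the base. *)
Lemma expansion l t v : (t + l <= n)%N -> vol (y (t + l)) <= B ^+ l * vol (y t) ->
  in_span (y (t + l)) v -> rnorm v <= E ^+ l * rnorm (word a t l v).
Proof.
move=> tl volB yv; case: l tl volB yv => [|l] tl volB yv; first by rewrite mul1r.
have bA w : rnorm (word a t l.+1 w) <= A ^+ l.+1 * rnorm w.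
  by rewrite (le_trans (opnormP _ _))// ler_wpM2r ?rnorm_ge0 ?opnorm_word.
have := conorm_ge (y0 tl) bA (exprn_ge0 _ (ltW A0)) yv.
rewrite -word_image//.
have tn : (t <= n)%N by apply: leq_trans tl; rewrite leq_addr.
have vt := y0 tn; have vtl := y0 tl.
set N := rnorm (word a t l.+1 v); move=> h.
have N0 : 0 <= N by exact: rnorm_ge0.
rewrite -(ler_pM2l vt) (le_trans h)//.
have -> : vol (y t) * (E ^+ l.+1 * N) =
    (2 * k.+1%:R) ^+ l.+1 * (A ^+ l.+1) ^+ k * (B ^+ l.+1 * vol (y t)) * N.
  by rewrite /E /expansion_const !exprMn -!exprM [(k * _)%N]mulnC; ring.
rewrite ler_wpM2r//; apply: ler_pM => //; rewrite ?(ltW vtl)//.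
  by rewrite mulr_ge0// !exprn_ge0// ltW.
rewrite ler_wpM2r ?exprn_ge0 ?(ltW A0)// exprS ler_peMr// exprn_ege1//.
have : 1 <= k.+1%:R :> R by rewrite ler1n.
lra.
Qed.

(** Between such times the (k+2)-volumes contract much faster than the (k+1)-volumes,
    so [quotient_contraction] applies. *)
Lemma contraction l t v x0 r : (t + l <= n)%N -> vol (y (t + l)) <= B ^+ l * vol (y t) ->
  in_span (y (t + l)) x0 -> 0 < r -> rnorm (v - x0) <= r ->
  exists2 x1, in_span (y (t + l)) x1 &
    rnorm (word a t l v - word a t l x1) <= L ^+ l * r.
Proof.
case: l => [|l] tl volB yx0 r0 vr; first by exists x0 => //; rewrite mul1r.
have tn : (t <= n)%N by apply: leq_trans tl; rewrite leq_addr.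
have vt := y0 tn; have vtl := y0 tl.
have vw : 0 < vol (word a t l.+1 \o y (t + l.+1)) by rewrite -word_image.
have [x1 yx1 h] := quotient_contraction vtl vw (exprn_gt0 l.+1 kap0) r0
   (fun z => vol_word z tl) yx0 vr.
exists x1 => //; apply: le_trans h _; rewrite -word_image//.
rewrite ler_pdivrMr//.
have -> : L ^+ l.+1 * r * vol (y t) =
   (2 * snoc_const R k.+1) ^+ l.+1 * kap ^+ l.+1 * r * (B ^+ l.+1 * vol (y t)).
  by rewrite /L /contraction_const !exprMn; ring.
apply: ler_pM => //; first by rewrite !mulr_ge0 ?exprn_ge0 ?ltW// snoc_const_gt0.
  exact: ltW.
rewrite ler_pM2r// ler_pM2r ?exprn_gt0// exprS ler_peMr//.
  by rewrite mulr_ge0// ltW// snoc_const_gt0.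
rewrite exprn_ege1// mulr_ege1// ?ler1n// /snoc_const mulr_ege1//.
  by rewrite exprn_ege1// ler1n.
by rewrite ler1n fact_gt0.
Qed.

Variable (j : nat).
Hypothesis jn : (j <= n)%N.
Hypothesis jrec : forall t l, (t + l = j)%N -> vol (y j) <= B ^+ l * vol (y t).
Hypothesis EL : E * L <= 1 / 16.

Let AE0 : 0 < A * E. Proof. exact: mulr_gt0. Qed.
Let AE1 : 1 <= A * E. Proof. exact: mulr_ege1. Qed.

(** Wide enough to absorb the distance between E_i and E_j, narrow enough for the
    components outside E_j not to disturb the motion inside. *)
Definition cone_width : R := 1 / (16 * (A * E)).
Let eta := cone_width.

Let eta0 : 0 < eta. Proof. by rewrite divr_gt0// mulr_gt0. Qed.
Let etaAE : eta * (A * E) = 1 / 16.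
Proof. by rewrite /eta /cone_width; field; rewrite !gt_eqF. Qed.
Let eta1 : eta <= 1 / 16.
Proof. by rewrite -etaAE ler_peMr// ltW. Qed.

Definition in_cone v := exists2 x0, in_span (y j) x0 & rnorm (v - x0) <= eta * rnorm v.

(** A vector of the cone is shadowed by a vector w of E_j, and w hardly depends on
    the length l of the product: passing from l to l+1 changes the shadow at time t
    by a distance of order L^l, hence, pulled back to E_j by [expansion], the
    vector w by a distance of order (E L)^l, which is summable.  Comparing the
    shadows in E_j, and not the components along the way, is what makes the
    estimate independent of l. *)
Lemma cone_shadow l t v : (t + l = j)%N -> v != 0 -> in_cone v ->
  exists w, [/\ in_span (y j) w,
    rnorm (word a t l v - word a t l w) <= L ^+ l * (eta * rnorm v) &
    rnorm (w - v) <= eta * rnorm v * (1 + 4 * (A * E) * (1 - 2^-1 ^+ l))].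
Proof.
move=> tl v0 [x0 yx0 vx0]; have r0 : 0 < eta * rnorm v by rewrite mulr_gt0// rnorm_gt0.
set r := eta * rnorm v in vx0 r0 *.
elim: l t tl => [|l IH] t tl.
  by exists x0; split => //; rewrite ?mul1r// expr0 subrr mulr0 addr0 mulr1 rnormB_sym.
have [|w [yw vw wv]] := IH t.+1; first by rewrite addSnnS.
have tln : (t + l.+1 <= n)%N by rewrite tl.
have yj : y (t + l.+1) = y j by rewrite tl.
have volB : vol (y (t + l.+1)) <= B ^+ l.+1 * vol (y t) by rewrite yj; exact: jrec.
have [|w1] := @contraction l.+1 t v x0 r tln volB _ r0 vx0; rewrite yj// => yw1 vw1.
exists w1; split => //.
have tn : (t < n)%N by apply: leq_trans tln; rewrite addnS ltnS leq_addr.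
have Ll : 0 < L ^+ l by exact: exprn_gt0.
have L1 : L <= 1 by move: EL E1 L0; nra.
(* At time t both w1 and the shadow w found for time t+1 are close to v. *)
have d1 : rnorm (word a t l.+1 (w1 - w)) <= 2 * (A * (L ^+ l * r)).
  rewrite linearB; apply: le_trans (rnorm_triangle (word a t l.+1 v) _ _) _.
  have -> : 2 * (A * (L ^+ l * r)) = A * (L ^+ l * r) + A * (L ^+ l * r) by ring.
  apply: lerD.
    rewrite rnormB_sym (le_trans vw1)// exprS -mulrA ler_pM2r ?(le_trans L1)//.
    exact: mulr_gt0.
  rewrite !wordS -linearB (le_trans (opnormP _ _))//.
  by apply: ler_pM => //; rewrite ?opnorm_ge0 ?rnorm_ge0 ?aA.
have d2 : rnorm (w1 - w) <= 2 * (A * E) * r * 2^-1 ^+ l.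
  have yww : in_span (y (t + l.+1)) (w1 - w) by rewrite yj; exact: in_spanB.
  apply: le_trans (expansion tln volB yww) _.
  apply: le_trans (ler_wpM2l (exprn_ge0 _ (ltW E0)) d1) _.
  have -> : E ^+ l.+1 * (2 * (A * (L ^+ l * r))) = 2 * (A * E) * r * (E * L) ^+ l.
    exact: cone_arith.
  apply: ler_wpM2l; first by rewrite mulr_ge0 ?(ltW r0)// mulr_ge0// ltW.
  have EL0 : 0 <= E * L by rewrite mulr_ge0// ltW.
  have EL2 : E * L <= 2^-1 by move: EL; lra.
  by apply: lerXn2r; rewrite ?nnegrE ?invr_ge0.
apply: le_trans (rnorm_triangle w _ _) _; apply: le_trans (lerD d2 wv) _.
rewrite exprS; set p := 2^-1 ^+ l; rewrite le_eqVlt; apply/orP; left; apply/eqP.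
by field.
Qed.

Variables (i l : nat) (gam : R).
Hypothesis il : (i + l = j)%N.
Hypothesis l0 : (0 < l)%N.
Hypothesis gap : forall u, in_span (y i) u ->
  exists2 u', in_span (y j) u' & rnorm (u - u') <= gam * rnorm u.
Hypothesis gam_eta : 0 <= gam <= eta / 4.

(** By [cone_shadow] the vector moves like its shadow, up to a component that
    contracts; so its image is much closer to E_i, relative to its norm, than eta,
    and E_i is within eta/4 of E_j. *)
Lemma cone_invariant v : v != 0 -> in_cone v ->
  in_cone (word a i l v) /\ rnorm v <= (4 * E) ^+ l * rnorm (word a i l v).
Proof.
move=> v0 cv; have [w [yw vw wv]] := cone_shadow il v0 cv.
have nv : 0 < rnorm v by rewrite rnorm_gt0.
have El : 0 < E ^+ l by exact: exprn_gt0.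
have wv2 : rnorm (w - v) <= 5 / 16 * rnorm v.
  apply: le_trans wv _.
  have -> : 5 / 16 * rnorm v = eta * rnorm v * (5 * (A * E)).
    by transitivity (5 * (eta * (A * E)) * rnorm v); [rewrite etaAE; field|ring].
  rewrite (ler_pM2l (mulr_gt0 eta0 nv)).
  have : 0 <= 2^-1 ^+ l :> R by rewrite exprn_ge0.
  by move=> /(mulr_ge0 (ltW AE0)); move: AE1; lra.
have w_ge : 11 / 16 * rnorm v <= rnorm w.
  by have := rnorm_le_sub v w; rewrite rnormB_sym; lra.
have volB : vol (y (i + l)) <= B ^+ l * vol (y i) by rewrite il; exact: jrec.
have iln : (i + l <= n)%N by rewrite il.
have yw' : in_span (y (i + l)) w by rewrite il.
have bw := expansion iln volB yw'.
have ELl : E ^+ l * L ^+ l <= 1 / 16.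
  rewrite -exprMn; apply: le_trans EL; rewrite -[leRHS]expr1.
  have EL0 : 0 <= E * L by rewrite mulr_ge0// ltW.
  have EL2 : E * L <= 1 by move: EL; lra.
  by rewrite ler_wiXn2l.
set bv := word a i l v in vw *; set bw' := word a i l w in vw bw.
have err : E ^+ l * rnorm (bv - bw') <= eta / 16 * rnorm v.
  apply: le_trans (ler_wpM2l (ltW El) vw) _.
  have -> : E ^+ l * (L ^+ l * (eta * rnorm v)) = E ^+ l * L ^+ l * (eta * rnorm v) by ring.
  have -> : eta / 16 * rnorm v = 1 / 16 * (eta * rnorm v) by field.
  by rewrite ler_wpM2r// ltW// mulr_gt0.
have tri : E ^+ l * rnorm bw' <= E ^+ l * rnorm (bv - bw') + E ^+ l * rnorm bv.
  by rewrite -mulrDr ler_pM2l// rnormB_sym rnorm_le_sub.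
have v_le : rnorm v <= 2 * (E ^+ l * rnorm bv).
  move: (ler_wpM2r (ltW nv) eta1) err tri bw w_ge; lra.
split; last first.
  apply: le_trans v_le _; rewrite [(4 * E) ^+ l]exprMn -[leRHS]mulrA.
  apply: ler_wpM2r; first by rewrite (mulr_ge0 (ltW El))// rnorm_ge0.
  apply: (@le_trans _ _ 4); first lra.
  by rewrite -[leLHS]expr1 ler_weXn2l//; lra.
have err2 : rnorm (bv - bw') <= eta / 8 * rnorm bv.
  rewrite -(ler_pM2l El); apply: le_trans err _.
  have -> : E ^+ l * (eta / 8 * rnorm bv) = eta / 16 * (2 * (E ^+ l * rnorm bv)) by field.
  by rewrite ler_wpM2l// divr_ge0// ltW.
have ybw : in_span (y i) bw' by rewrite (word_image iln); exact: in_span_image.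
have [u yu bu] := gap ybw.
exists u => //; apply: le_trans (rnorm_triangle bw' _ _) _.
have bw_le : rnorm bw' <= (1 + eta / 8) * rnorm bv.
  by have := rnorm_le_sub bw' bv; rewrite rnormB_sym; lra.
have nb := rnorm_ge0 bw'; have nbv := rnorm_ge0 bv.
have : gam * rnorm bw' <= eta / 4 * rnorm bw'.
  by rewrite ler_wpM2r//; case/andP: gam_eta.
have : eta / 4 * rnorm bw' <= eta / 4 * ((1 + eta / 8) * rnorm bv).
  by rewrite ler_wpM2l// divr_ge0// ltW.
have : eta * (eta * rnorm bv) <= eta * rnorm bv.
  by rewrite ler_pM2l// ler_piMl//; move: eta1; lra.
have : 0 <= eta * rnorm bv by rewrite mulr_ge0// ltW.
move: err2 bu; lra.
Qed.

Lemma cone_iterate v p : v != 0 -> in_cone v ->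
  rnorm v <= (4 * E) ^+ (l * p) * rnorm (op_pow (word a i l) p v).
Proof.
move=> v0 cv.
suff : in_cone (op_pow (word a i l) p v) /\
  rnorm v <= (4 * E) ^+ (l * p) * rnorm (op_pow (word a i l) p v) by case.
have E4 : 0 < 4 * E by rewrite mulr_gt0.
elim: p => [|p [IH1 IH2]]; first by rewrite muln0 mul1r.
have nv : 0 < rnorm v by rewrite rnorm_gt0.
have b0 : op_pow (word a i l) p v != 0.
  by rewrite -rnorm_gt0 -(pmulr_rgt0 _ (exprn_gt0 (l * p) E4)) (lt_le_trans nv).
have [c h] := cone_invariant b0 IH1.
split => //; apply: le_trans IH2 _.
by rewrite mulnS addnC exprD -mulrA ler_pM2l ?exprn_gt0.
Qed.

End Cone.

(** * Two good times with nearby subspaces *)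

Section Block.
Context (R : realType) (X : normedModType R[i]).
Implicit Types (M N : set (bounded_op X)).

Lemma pigeonhole (T : finType) (f : nat -> T) (s : seq nat) : uniq s -> (#|T| < size s)%N ->
  exists i j, [/\ (i < j)%N, i \in s, j \in s & f i = f j].
Proof.
move=> us Ts; apply: contrapT => /forallNP H.
have inj : {in s &, injective f}.
  move=> i j si sj fij; apply/eqP/negPn/negP; rewrite neq_ltn => /orP[ij|ji].
    by apply: (H i); exists j.
  by apply: (H j); exists i.
have := max_card (mem (map f s)); rewrite leqNgt; apply/negP/negPn.
suff /card_uniqP -> : uniq (map f s) by rewrite size_map.
by rewrite map_inj_in_uniq.
Qed.

(** The combinatorial core.  All requirements compare kap with powers of A, so that
    they hold for blocks of m factors when kap decays in m and A grows slowly. *)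
Lemma slow_return k N F (A kap : R) :
  let B := A ^+ (4 * k.+1) in
  let E := expansion_const k A B in
  let L := contraction_const k B kap in
  2 <= A -> 0 < kap -> E * L <= 1 / 16 -> 128 * (A * E) * (E * kap) <= 1 ->
  (forall b, N b -> opnorm b <= A) -> vol_bounded N (k.+1 + 1) 1 kap -> ball_cover N F kap ->
  ~ vol_contracting N k.+1 ->
  exists l b v, [/\ (0 < l)%N, opset_exp N l b, v != 0 &
    forall p, rnorm v <= (4 * E) ^+ (l * p) * rnorm (op_pow b p v)].
Proof.
move=> B E L A2 kap0 EL EK NA Nvol NF Nk.
have A0 : 0 < A by lra.
have A1 : 1 <= A by lra.
have B2 : 2 <= B.
  by apply: le_trans A2 _; rewrite -[leLHS]expr1 ler_weXn2l// mulnS.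
have B0 : 0 < B by lra.
have B1 : 1 <= B by lra.
have E1 : 1 <= E by exact: expansion_const_ge1.
have E0 : 0 < E by lra.
pose I := 'I_(size F).
(* Enough steps for more good times than there are colours. *)
pose n := (10 * (#|{set I}|).+1)%N.
have n0 : (0 < n)%N by [].
have h1 : 1 / 2 < 1 :> R by lra.
have h2 : 0 <= 1 / 2 :> R by lra.
have [_ [x [/exp_word[a Na ->] x0 bx]]] := not_vol_contracting n0 h1 h2 Nk.
pose y t := word a t (n - t) \o x.
have yn : y n = x by rewrite /y subnn.
have yE t : (t < n)%N -> y t = a t \o y t.+1.
  by move=> tn; rewrite /y -(subnSK tn).
have aA t : (t < n)%N -> opnorm (a t) <= A by move=> /Na /NA.
have avol t : (t < n)%N -> forall z : 'I_(k.+1 + 1) -> X, vol (a t \o z) <= kap * vol z.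
  by move=> /Na Nt z; apply: Nvol; rewrite opset_exp1.
have ystep t : (t < n)%N -> vol (y t) <= A ^+ k.+1 * vol (y t.+1).
  move=> tn; rewrite yE//; apply: vol_image_le (ltW A0) => v.
  by rewrite (le_trans (opnormP _ _))// ler_wpM2r ?rnorm_ge0 ?aA.
have y00 : 0 < vol (y 0%N).
  by apply: lt_le_trans bx; rewrite mulr_gt0.
have y0 t : (t <= n)%N -> 0 < vol (y t).
  elim: t => // t IH tn; rewrite -(pmulr_rgt0 _ (exprn_gt0 k.+1 A0)).
  exact: lt_le_trans (IH (ltnW tn)) (ystep t tn).
have lnB : 0 < ln B by rewrite ln_gt0//; lra.
(* In this scale a step of h is at least -1 - 1/4, because A^(k+1) is the fourth
   root of B, and t + l is a record only if d_(t+l) <= B^l d_t. *)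
pose h t : R := ln (vol (y t)) / ln B - t%:R.
have hstep t : (t < n)%N -> h t - 5 / 4 <= h t.+1.
  move=> tn; rewrite /h -[t.+1%:R]natr1.
  have yt := y0 _ (ltnW tn); have yt1 := y0 _ tn.
  have : ln (vol (y t)) <= ln (A ^+ k.+1 * vol (y t.+1)).
    by rewrite ler_ln ?posrE ?mulr_gt0 ?exprn_gt0 ?ystep.
  rewrite lnM ?posrE ?exprn_gt0// => le1.
  have : ln (vol (y t)) / ln B <= 1 / 4 + ln (vol (y t.+1)) / ln B.
    rewrite ler_pdivrMr// mulrDl divfK ?gt_eqF// (le_trans le1)// lerD2r.
    have -> : ln B = 4 * ln (A ^+ k.+1) by rewrite /B mulnC exprM lnXn ?exprn_gt0// mulr_natl.
    lra.
  lra.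
have hn : h n <= h 0%N + 1 - n%:R.
  rewrite /h subr0 lerD2r yn.
  have : ln (1 / 2 * vol x) <= ln (vol (y 0%N)) by rewrite ler_ln ?posrE ?mulr_gt0.
  rewrite lnM ?posrE// div1r lnV ?posrE// => le1.
  have : ln 2 <= ln B by rewrite ler_ln ?posrE.
  move=> le2; rewrite -(ler_pM2r lnB) mulrDl mul1r !divfK ?gt_eqF//; lra.
have recP t l : (t + l <= n)%N -> record_min h (t + l) ->
    vol (y (t + l)%N) <= B ^+ l * vol (y t).
  move=> tln /record_minP rec; have [->|l0] := posnP l; first by rewrite addn0 mul1r.
  have := rec t; rewrite -[X in (X < _)%N]addn0 ltn_add2l => /(_ l0).
  have yt : 0 < vol (y t) by apply: y0; apply: leq_trans tln; rewrite leq_addr.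
  rewrite /h natrD => le1.
  have Bl : 0 < B ^+ l by rewrite exprn_gt0.
  have ytl := y0 _ tln.
  rewrite -ler_ln ?posrE ?mulr_gt0// lnM ?posrE// lnXn// -[ln B *+ l]mulr_natl.
  have : ln (vol (y (t + l)%N)) / ln B <= ln (vol (y t)) / ln B + l%:R by lra.
  by rewrite ler_pdivrMr// mulrDl divfK ?gt_eqF// addrC.
pose good j := record_min h j && record_min h j.+1.
pose s := [seq j <- iota 0 n | good j].
have us : uniq s by rewrite filter_uniq// iota_uniq.
have sn j : j \in s -> (j < n)%N by rewrite mem_filter mem_iota add0n => /andP[_].
have sgood j : j \in s -> good j by rewrite mem_filter => /andP[].
(* Two times with the same colour have unit balls that approximate each other within
   2 kap E: the vectors of E_j are images, under one factor, of vectors at most E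
   times as long, so that the cover of the image of the unit ball applies. *)
pose colour j : {set I} := finset (fun c : I => `[< exists2 u, in_span (y j) u &
   rnorm ((E^-1)%:C%C *: u - nth 0 F c) <= kap >]).
have [|i [j [ij si sj cij]]] := @pigeonhole _ colour s us.
  by rewrite size_filter; apply: many_records.
have jn := sn _ sj; have i_n := sn _ si.
have /andP[rj _] := sgood _ sj; have /andP[_ ri] := sgood _ si.
have jrec t l : (t + l = j)%N -> vol (y j) <= B ^+ l * vol (y t).
  by move=> tl; rewrite -tl; apply: recP; rewrite tl// ltnW.
have il : (i + (j - i) = j)%N by rewrite subnKC// ltnW.
have l0 : (0 < j - i)%N by rewrite subn_gt0.
pose gam := 2 * kap * E.
have gapP u : in_span (y i) u ->
    exists2 u', in_span (y j) u' & rnorm (u - u') <= gam * rnorm u.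
  move=> yu; have [->|u0] := eqVneq u 0.
    by exists 0; [exact: in_span0|rewrite subrr !rnorm0 mulr0].
  have nu : 0 < rnorm u by rewrite rnorm_gt0.
  pose e := ((rnorm u)^-1)%:C%C *: u.
  have ne : rnorm e = 1 by rewrite rnormZ modc_real gtr0_norm ?invr_gt0// mulVf ?gt_eqF.
  have ye : in_span (a i \o y i.+1) e by rewrite -yE//; exact: in_spanZ.
  have [w yw ew] := in_span_imageP ye.
  have wE : rnorm w <= E.
    have i1n : (i + 1 <= n)%N by rewrite addn1.
    have vi : vol (y (i + 1)%N) <= B ^+ 1 * vol (y i) by apply: recP => //; rewrite addn1.
    have yw' : in_span (y (i + 1)%N) w by rewrite addn1.
    have := expansion A1 aA yE y0 i1n vi yw'.
    by rewrite /= expr1 -ew ne mulr1.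
  have nE : rnorm ((E^-1)%:C%C *: w) <= 1.
    by rewrite rnormZ modc_real gtr0_norm ?invr_gt0// ler_pdivrMl// mulr1.
  have [c cF awc] := NF (a i) _ (Na _ i_n) nE.
  have iF : (index c F < size F)%N by rewrite index_mem.
  have ci : Ordinal iF \in colour i.
    rewrite inE; apply/asboolP; exists e; first by rewrite yE.
    by rewrite /= nth_index//; move: awc; rewrite linearZ /= -ew.
  move: ci; rewrite cij inE => /asboolP[u' yu' /=]; rewrite nth_index// => u'c.
  exists ((rnorm u)%:C%C *: u'); first exact: in_spanZ.
  have -> : u - (rnorm u)%:C%C *: u' = (rnorm u)%:C%C *: (e - u').
    by rewrite scalerBr scalerA -rmorphM mulfV ?gt_eqF// rmorph1 scale1r.
  rewrite rnormZ modc_real gtr0_norm// mulrC ler_pM2r//.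
  have -> : e - u' = E%:C%C *: ((E^-1)%:C%C *: e - (E^-1)%:C%C *: u').
    by rewrite -scalerBr scalerA -rmorphM mulfV ?gt_eqF// rmorph1 scale1r.
  rewrite rnormZ modc_real gtr0_norm// mulrC ler_pM2r//.
  apply: le_trans (rnorm_triangle c _ _) _.
  rewrite [2 * kap]mulr_natl mulr2n lerD//; last by rewrite rnormB_sym.
  by move: awc; rewrite linearZ /= -ew.
have gam_eta : 0 <= gam <= cone_width k A B / 4.
  apply/andP; split; first by rewrite (mulr_ge0 (mulr_ge0 _ (ltW kap0)) (ltW E0)).
  have AE : 0 < 16 * (A * E) by rewrite mulr_gt0// mulr_gt0.
  rewrite /cone_width -/E ler_pdivlMr// ler_pdivlMr//.
  by rewrite /gam; move: EK; lra.
pose v := y j ord0.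
have v0 : v != 0.
  have := y0 _ (ltnW jn); rewrite -rnorm_gt0 => vj.
  rewrite lt_neqAle rnorm_ge0 andbT; apply: contraTneq vj => v0.
  by rewrite -leNgt (le_trans (vol_le _))// big_ord_recl -v0 mul0r.
exists (j - i)%N; exists (word a i (j - i)%N); exists v; split => //.
  apply: word_exp => t /andP[_]; rewrite il => tj.
  by apply: Na; apply: ltn_trans tj jn.
move=> p.
apply: (cone_iterate A1 B1 kap0 aA avol yE y0 (ltnW jn) jrec EL il l0 gapP gam_eta p v0).
exists v; first exact: in_span_tuple.
by rewrite subrr rnorm0 mulr_ge0 ?rnorm_ge0// divr_ge0// mulr_ge0// mulr_ge0 ?ltW.
Qed.

End Block.

(** * Products that hardly contract one orbit *)

Lemma common_bound (a b c d e : nat) : exists m : nat,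
  [/\ (0 < m)%N, (a <= m)%N, (b <= m)%N, (c <= m)%N & (d <= m)%N /\ (e <= m)%N].
Proof. by exists (a + b + c + d + e).+1; split; try split; lia. Qed.

Lemma exponent_identities k : [/\ (k + 4 * k.+1 = 5 * k + 4)%N,
  (5 * k + 4 + 4 * k.+1 = 9 * k + 8)%N,
  ((5 * k + 4).+1 + (5 * k + 4) = 10 * k + 9)%N,
  (9 * k + 8 <= 10 * k + 9)%N & (5 * k + 4 <= 10 * k + 9)%N].
Proof. by split; lia. Qed.

Section NearEigenvector.
Context (R : realType) (X : normedModType R[i]).
Implicit Types (M N : set (bounded_op X)).

Lemma vol1 (x : 'I_1 -> X) : vol x = rnorm (x ord0).
Proof.
apply/eqP; rewrite eq_le; apply/andP; split.
  by rewrite (le_trans (vol_le _))// big_ord1.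
have := @vol_ge_indep _ _ 1 x (rnorm (x ord0)) (rnorm_ge0 _).
rewrite expr1 divr1; apply => c i.
rewrite /comb big_ord1 (ord1 i) rnormZ [leLHS]mulrC; exact: lexx.
Qed.

Lemma not_vol_contracting1 M :
  (forall n c, (0 < n)%N -> c < 1 -> exists2 b, opset_exp M n b & c < opnorm b) ->
  ~ vol_contracting M 1.
Proof.
move=> Mbig [n [c [n0 c1 Mc]]].
have m1 : Num.max 0 c < 1 by rewrite gt_max ltr01.
have [b Mb] := Mbig n _ n0 m1; apply/negP; rewrite -leNgt.
apply: opnorm_leP => [|v]; first by rewrite le_max lexx.
have := Mc b (fun=> v) Mb; rewrite !vol1 /= => /le_trans; apply.
by rewrite ler_wpM2r ?rnorm_ge0// le_max lexx orbT.
Qed.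

Lemma vol_contracting_switch M k : ~ vol_contracting M 1 -> vol_contracting M k.+1 ->
  exists j, ~ vol_contracting M j.+1 /\ vol_contracting M j.+2.
Proof.
move=> M1; elim: k => [/M1//|k IH Mk].
by have [/IH//|Mk'] := pselect (vol_contracting M k.+1); exists k.
Qed.

(** [slow_return] for the blocks M^m: norms on M^m are at most (1+e)^m with e as
    small as desired, while the rates of contraction of (k+2)-volumes and of
    covering radii are fixed numbers below 1. *)
Lemma near_eigenvector M t0 m0 g :
  (forall n c, (0 < n)%N -> c < 1 -> exists2 b, opset_exp M n b & c < opnorm b) ->
  subexp_growth M -> 0 < t0 < 1 ->
  (forall m, (m0 <= m)%N -> exists F, ball_cover (opset_exp M m) F (t0 ^+ m)) ->
  1 < g ->
  exists n b v, [/\ (0 < n)%N, opset_exp M n b, v != 0 &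
    forall p, rnorm v <= (g ^+ n) ^+ p * rnorm (op_pow b p v)].
Proof.
move=> Mbig Mg /andP[t00 t01] Mcov g1.
have M1 : op_bounded M.
  by have [C _ hC] := Mg 1 ltr01; exists (C * (1 + 1) ^+ 1); exact: hC.
have [K MK] : exists K, vol_contracting M K.+1.
  have [F hF] := Mcov m0.+1 (leqnSn _).
  apply: (vol_contracting_large (q := m0.+1) _ _ hF Mg) => //.
  by rewrite exprn_gt0//= exprn_ilt1// ltW.
have [k [Mk Mk1]] := vol_contracting_switch (not_vol_contracting1 Mbig) MK.
rewrite -[k.+2]addn1 in Mk1.
have [C [c [C0 /andP[c0 c1] Mvol]]] := vol_bounded_growth M1 Mk1.
(* C' w^m will bound both the factor for (k+2)-volumes and the covering radius. *)
pose w := Num.max c t0.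
have w0 : 0 < w by rewrite lt_max c0.
have w1 : w < 1 by rewrite gt_max c1.
pose C' := Num.max C 1.
have C'0 : 0 < C' by rewrite lt_max C0.
(* The highest power of A in the requirements of slow_return; y is the growth allowed
   to A^P per factor of the block. *)
pose P := (10 * k + 9)%N.
pose y := Num.min ((1 + w^-1) / 2) ((1 + g) / 2).
have wi : 1 < w^-1 by rewrite invf_gt1.
have y1 : 1 < y by rewrite lt_min; apply/andP; split; lra.
have yw : y * w < 1.
  apply: (@le_lt_trans _ _ ((1 + w^-1) / 2 * w)).
    by rewrite ler_pM2r// ge_min lexx.
  by rewrite mulrAC mulrDl mulVf ?gt_eqF//; lra.
have yg : y / g < 1.
  rewrite ltr_pdivrMr ?mul1r; last by lra.
  by apply: (@le_lt_trans _ _ ((1 + g) / 2)); [rewrite ge_min lexx orbT|lra].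
have [e e0 ey] := @small_root _ y P y1.
have e20 : 0 < e / 2 by rewrite divr_gt0.
have [C2 C20 hC2] := Mg _ e20.
have e1 : (1 + e / 2) / (1 + e) < 1 by rewrite ltr_pdivrMr; lra.
pose D : R := 512 * k.+1%:R ^+ 2 * (1 + snoc_const R k.+1) * C'.
have e10 : 0 <= (1 + e / 2) / (1 + e) by rewrite divr_ge0//; lra.
have [n1 h1] := geometric_small C2 e10 e1 ltr01.
have e11 : 1 < 1 + e by lra.
have [n2 h2] := geometric_large 2 e11.
have yw0 : 0 <= y * w by rewrite mulr_ge0//; lra.
have [n3 h3] := geometric_small D yw0 yw ltr01.
have yg0 : 0 <= y / g by rewrite divr_ge0//; lra.
have [n4 h4] := geometric_small (8 * k.+1%:R) yg0 yg ltr01.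
have [m [mpos m0m n1m n2m [n3m n4m]]] := common_bound m0 n1 n2 n3 n4.
have [x1 x2 x3 x4 x5] := exponent_identities k.
have {}h1 : C2 * ((1 + e / 2) / (1 + e)) ^+ m < 1 by exact: h1.
have {}h2 : 2 < (1 + e) ^+ m by exact: h2.
have {}h3 : D * (y * w) ^+ m < 1 by exact: h3.
have {}h4 : 8 * k.+1%:R * (y / g) ^+ m < 1 by exact: h4.
pose A := (1 + e) ^+ m.
have A0 : 0 < A by rewrite /A; lra.
have A1 : 1 <= A by rewrite /A; lra.
have g0 : 0 < g by lra.
have y0 : 0 < y by lra.
have gm : 0 < g ^+ m by rewrite exprn_gt0.
have wm : 0 < w ^+ m by rewrite exprn_gt0.
have ym : 0 < y ^+ m by rewrite exprn_gt0.
have AP q : (q <= P)%N -> A ^+ q <= y ^+ m.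
  move=> qP; apply: (@le_trans _ _ (A ^+ P)); first exact: ler_weXn2l.
  rewrite /A -exprM mulnC exprM; apply: lerXn2r => //; rewrite nnegrE ?exprn_ge0//; lra.
pose kap := C' * w ^+ m.
have kap0 : 0 < kap by rewrite mulr_gt0.
have kapy : D / C' * (kap * y ^+ m) <= 1.
  apply: ltW; apply: le_lt_trans h3.
  by rewrite /kap exprMn le_eqVlt; apply/orP; left; apply/eqP; field; rewrite gt_eqF.
pose E := expansion_const k A (A ^+ (4 * k.+1)).
have EE : E = 2 * k.+1%:R * A ^+ (5 * k + 4).
  by rewrite /E /expansion_const -mulrA -exprD x1.
pose L := contraction_const k (A ^+ (4 * k.+1)) kap.
have k1 : 1 <= k.+1%:R :> R by rewrite ler1n.
have s0 := snoc_const_gt0 R k.+1.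
have DC : D / C' = 512 * k.+1%:R ^+ 2 * (1 + snoc_const R k.+1).
  by rewrite /D mulfK// gt_eqF.
have EL : E * L <= 1 / 16.
  have -> : E * L = 4 * k.+1%:R * snoc_const R k.+1 * (kap * A ^+ (9 * k + 8)).
    rewrite EE /L /contraction_const.
    have -> : A ^+ (9 * k + 8) = A ^+ (5 * k + 4) * A ^+ (4 * k.+1).
      by rewrite -exprD x2.
    by ring.
  rewrite ler_pdivlMr// mulrC; apply: le_trans kapy.
  rewrite DC mulrA; apply: ler_pM.
  - by rewrite !mulr_ge0// ltW.
  - exact: mulr_ge0 (ltW kap0) (exprn_ge0 _ (ltW A0)).
  - move: k1 s0; move: (k.+1%:R) (snoc_const _ _) => a b; clear => a1 b0.
    have ab : 0 <= a * b by rewrite mulr_ge0//; lra.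
    have : a * b <= a * (a * b) by rewrite ler_peMl.
    have : 0 <= a * a by rewrite mulr_ge0//; lra.
    lra.
  - by rewrite ler_pM2l// AP.
have EK : 128 * (A * E) * (E * kap) <= 1.
  have -> : 128 * (A * E) * (E * kap) = 512 * k.+1%:R ^+ 2 * (kap * A ^+ P).
    rewrite EE.
    have -> : A ^+ P = A * A ^+ (5 * k + 4) * A ^+ (5 * k + 4).
      by rewrite -exprS -exprD x3.
    by ring.
  apply: le_trans kapy; rewrite DC; apply: ler_pM.
  - by rewrite mulr_ge0// exprn_ge0.
  - exact: mulr_ge0 (ltW kap0) (exprn_ge0 _ (ltW A0)).
  - by rewrite ler_peMr ?mulr_ge0 ?exprn_ge0//; lra.
  - by rewrite ler_pM2l// AP.
have NA b : opset_exp M m b -> opnorm b <= A.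
  move=> /hC2 /le_trans; apply; move: h1.
  by rewrite expr_div_n mulrA ltr_pdivrMr ?mul1r// => /ltW.
have Nvol : vol_bounded (opset_exp M m) (k.+1 + 1) 1 kap.
  move=> b z; rewrite opset_exp1 => Mb; apply: le_trans (Mvol _ _ _ Mb) _.
  rewrite ler_wpM2r ?vol_ge0// /kap; apply: ler_pM; rewrite ?exprn_ge0 ?(ltW C0) ?(ltW c0)//.
    by rewrite le_max lexx.
  by apply: lerXn2r; rewrite ?nnegrE ?(ltW c0) ?(ltW w0)// le_max lexx.
have Nk : ~ vol_contracting (opset_exp M m) k.+1.
  move=> [n [c' [n0 c'1 h]]]; apply: Mk; exists (m * n)%N, c'; split=> //.
    by rewrite muln_gt0 mpos.
  by move=> b z Mb; apply: h; rewrite opset_expM.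
have [F hF] : exists F, ball_cover (opset_exp M m) F (t0 ^+ m) by exact: Mcov.
have NF : ball_cover (opset_exp M m) F kap.
  move=> b u Mb u1; have [f fF uf] := hF b u Mb u1; exists f => //.
  apply: le_trans uf _; apply: (@le_trans _ _ (w ^+ m)).
    by apply: lerXn2r; rewrite ?nnegrE ?(ltW t00) ?(ltW w0)// le_max lexx orbT.
  by rewrite ler_peMl ?(ltW wm)// le_max lexx orbT.
have [l [b [v [l0 Nb v0 bv]]]] := slow_return (ltW h2) kap0 EL EK NA Nvol NF Nk.
exists (m * l)%N, b, v; split => //; first by rewrite muln_gt0 mpos.
  by rewrite -opset_expM.
move=> p; apply: le_trans (bv p) _; rewrite ler_wpM2r ?rnorm_ge0//.
have -> : (g ^+ (m * l)) ^+ p = (g ^+ m) ^+ (l * p) by rewrite -!exprM mulnA.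
rewrite -/E; apply: lerXn2r; rewrite ?nnegrE ?(ltW gm)//.
  by rewrite mulr_ge0// EE !mulr_ge0// exprn_ge0// ltW.
rewrite EE mulrA mulrA; apply: (@le_trans _ _ (8 * k.+1%:R * y ^+ m)).
  have -> : 4 * 2 = 8 :> R by ring.
  by rewrite ler_pM2l ?mulr_gt0// AP.
by move: h4; rewrite expr_div_n mulrA ltr_pdivrMr ?mul1r// => /ltW.
Qed.

End NearEigenvector.

(** * The joint spectral radius as an infimum *)

Section Radii.
Context (R : realType) (X : normedModType R[i]).
Implicit Types (M N : set (bounded_op X)).

Lemma root_le (a s : R) n : 0 <= a -> 0 <= s -> (0 < n)%N ->
  (a `^ n%:R^-1 <= s) = (a <= s ^+ n).
Proof.
move=> a0 s0 n0; have aE : (a `^ n%:R^-1) ^+ n = a.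
  by rewrite -powR_mulrn ?powR_ge0// -powRrM mulVf ?powRr1// pnatr_eq0 -lt0n.
by rewrite -{2}aE ler_pXn2r// ?nnegrE ?powR_ge0.
Qed.

Lemma root_ge (a s : R) n : 0 <= a -> 0 <= s -> (0 < n)%N ->
  (s <= a `^ n%:R^-1) = (s ^+ n <= a).
Proof.
move=> a0 s0 n0; have aE : (a `^ n%:R^-1) ^+ n = a.
  by rewrite -powR_mulrn ?powR_ge0// -powRrM mulVf ?powRr1// pnatr_eq0 -lt0n.
by rewrite -{2}aE ler_pXn2r// ?nnegrE ?powR_ge0.
Qed.

Lemma opset_norm_ge M c b : (forall a, M a -> opnorm a <= c) ->
  M b -> opnorm b <= opset_norm M.
Proof.
move=> Mc Mb; apply: ub_le_sup; last by exists b.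
by exists c => _ [a Ma <-]; exact: Mc.
Qed.

Lemma opset_norm_le M c : 0 <= c -> (forall a, M a -> opnorm a <= c) -> opset_norm M <= c.
Proof.
move=> c0 Mc; rewrite /opset_norm.
have [[b Mb]|/set0P/negP/negPn/eqP->] := pselect (M !=set0); last first.
  by rewrite image_set0 sup0.
by apply: ge_sup; [exists (opnorm b), b|move=> _ [a Ma <-]; exact: Mc].
Qed.

Lemma opset_norm_ge0 M : 0 <= opset_norm M.
Proof.
rewrite /opset_norm; set S := [set _ | _ in _].
have [Ss|Ss] := pselect (has_sup S); last by rewrite (sup_out Ss).
have [r [a Ma ar]] := Ss.1.
by rewrite (le_trans (opnorm_ge0 a))//; apply: (sup_upper_bound Ss); exists a.
Qed.

Lemma op_bounded_exp M : op_bounded M -> forall n, exists c, exp_bounded M n c.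
Proof.
move=> [c Mc]; pose s := Num.max 1 c.
have s0 : 0 < s by rewrite lt_max ltr01.
have Ms : exp_bounded M 1 (s ^+ 1).
  by move=> b /Mc bc; rewrite expr1 (le_trans bc)// le_max lexx orbT.
have [C C0 hC] := exp_bounded_growth (ex_intro _ c Mc) (ltn0Sn 0) s0 Ms.
by move=> n; exists (C * s ^+ n).
Qed.

Lemma exp_boundedE M n c : op_bounded M -> 0 <= c ->
  exp_bounded M n c <-> opset_norm (opset_exp M n) <= c.
Proof.
move=> Mb c0; split => [h|h b Mbb]; first exact: opset_norm_le.
have [d hd] := op_bounded_exp Mb n.
exact: le_trans (opset_norm_ge hd Mbb) h.
Qed.

Definition norm_roots M : set R :=
  [set opset_norm (opset_exp M n) `^ n%:R^-1 | n in [set n | (0 < n)%N]].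

Lemma norm_roots_has_inf M : has_inf (norm_roots M).
Proof.
split; first by exists (opset_norm (opset_exp M 1) `^ 1%:R^-1), 1%N.
by exists 0 => _ [n _ <-]; exact: powR_ge0.
Qed.

Lemma norm_roots_upper M s : op_bounded M -> inf (norm_roots M) < s ->
  exists2 C, 0 < C & forall n, exp_bounded M n (C * s ^+ n).
Proof.
move=> Mb /(inf_lt (norm_roots_has_inf M).1)[_ [p /= p0 <-] lt].
have s0 : 0 < s by apply: le_lt_trans lt; exact: powR_ge0.
apply: (exp_bounded_growth Mb p0 s0); apply/exp_boundedE => //.
  by rewrite exprn_ge0// ltW.
by rewrite -root_le ?opset_norm_ge0 ?ltW.
Qed.

(** Fekete's lemma. *)
Lemma joint_spectral_radius_cvg M : op_bounded M ->
  (fun n => opset_norm (opset_exp M n) `^ n%:R^-1) @ \oo --> inf (norm_roots M).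
Proof.
move=> Mb; have r0 : 0 <= inf (norm_roots M).
  by apply: lb_le_inf; [exact: (norm_roots_has_inf M).1|move=> _ [n _ <-]; exact: powR_ge0].
apply/cvgrPdist_le => e e0; set r := inf (norm_roots M) in r0 *.
have rs : r < r + e / 2 by rewrite ltrDl divr_gt0.
have s0 : 0 < r + e / 2 by apply: le_lt_trans rs.
have [C C0 hC] := norm_roots_upper Mb rs.
have q1 : 1 < (r + e) / (r + e / 2) by rewrite ltr_pdivlMr// mul1r ltrD2l; lra.
have [n0 hn0] := geometric_large C q1.
exists n0.+1 => // n /= n0n.
have np : (0 < n)%N by apply: leq_ltn_trans n0n.
rewrite ler_distlC; apply/andP; split.
  rewrite (@le_trans _ _ r)//; first by rewrite gerBl ltW.
  by apply: ge_inf; [exact: (norm_roots_has_inf M).2|exists n].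
have re0 : 0 <= r + e by lra.
rewrite root_le ?opset_norm_ge0//.
apply/(exp_boundedE _ Mb); first exact: exprn_ge0.
move=> b /hC /le_trans; apply.
by rewrite -ler_pdivlMr ?exprn_gt0// -expr_div_n ltW// hn0// ltnW.
Qed.

Lemma joint_spectral_radiusE M : op_bounded M -> joint_spectral_radius M = inf (norm_roots M).
Proof. by move=> /joint_spectral_radius_cvg/cvg_lim; exact. Qed.

Lemma joint_spectral_radius_ge0 M : op_bounded M -> 0 <= joint_spectral_radius M.
Proof.
move=> Mb; rewrite joint_spectral_radiusE//.
by apply: lb_le_inf; [exact: (norm_roots_has_inf M).1|move=> _ [n _ <-]; exact: powR_ge0].
Qed.

Lemma joint_spectral_radius_lower M n : op_bounded M -> (0 < n)%N ->
  joint_spectral_radius M ^+ n <= opset_norm (opset_exp M n).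
Proof.
move=> Mb n0; rewrite -root_ge ?opset_norm_ge0 ?joint_spectral_radius_ge0//.
rewrite joint_spectral_radiusE//.
by apply: ge_inf; [exact: (norm_roots_has_inf M).2|exists n].
Qed.

Lemma joint_spectral_radius_upper M s : op_bounded M -> joint_spectral_radius M < s ->
  exists2 C, 0 < C & forall n, exp_bounded M n (C * s ^+ n).
Proof. by move=> Mb; rewrite joint_spectral_radiusE//; exact: norm_roots_upper. Qed.

Lemma op_bounded1 (T : bounded_op X) : op_bounded [set T].
Proof. by exists (opnorm T) => b; rewrite opset_exp1 => ->. Qed.

Lemma spectral_radius_ge0 (T : bounded_op X) : 0 <= spectral_radius T.
Proof. exact/joint_spectral_radius_ge0/op_bounded1. Qed.

Lemma spectral_radius_le (T : bounded_op X) : spectral_radius T <= opnorm T.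
Proof.
have := joint_spectral_radius_lower (op_bounded1 T) (ltn0Sn 0).
rewrite expr1 => /le_trans; apply; apply: opset_norm_le (opnorm_ge0 _) _.
by move=> b; rewrite opset_exp1 => ->.
Qed.

(** A single orbit that decays no faster than K^(-p) bounds the spectral radius from
    below: were the spectral radius smaller, the powers of K T would tend to 0. *)
Lemma spectral_radius_ge (T : bounded_op X) v K : v != 0 -> 0 < K ->
  (forall p, rnorm v <= K ^+ p * rnorm (op_pow T p v)) -> K^-1 <= spectral_radius T.
Proof.
move=> v0 K0 h; rewrite leNgt; apply/negP => lt.
have nv : 0 < rnorm v by rewrite rnorm_gt0.
(* Any number strictly between the spectral radius and 1/K. *)
pose s := (spectral_radius T + K^-1) / 2.
have s0 : spectral_radius T < s by rewrite /s; lra.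
have sp : 0 < s by apply: le_lt_trans s0; exact: spectral_radius_ge0.
have Ks1 : K * s < 1 by rewrite mulrC -ltr_pdivlMr// div1r /s; lra.
have Ks0 : 0 <= K * s by rewrite mulr_ge0// ltW.
have [C C0 hC] := joint_spectral_radius_upper (op_bounded1 T) s0.
have [p hp] := geometric_small C Ks0 Ks1 ltr01.
have := hp p (leqnn p); apply/negP; rewrite -leNgt -(ler_pM2r nv) mul1r.
apply: le_trans (h p) _; rewrite exprMn mulrCA -mulrA ler_pM2l ?exprn_gt0//.
apply: le_trans (opnormP _ _) _; rewrite ler_pM2r//.
by apply: hC; rewrite opset_exp_set1.
Qed.

End Radii.

(** * Upper limits *)

Section LimSup.
Context (R : realType).
Implicit Types (w v : nat -> R) (c : R).

Lemma limn_sup_lt w c : bounded_fun (w : R^o^nat) -> limn_sup w < c ->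
  exists n0, forall n, (n0 <= n)%N -> w n < c.
Proof.
move=> wb; rewrite limn_supE// => /inf_lt[|_ [n0 _ <-] lt].
  by exists (sups w 0%N), 0%N.
exists n0 => n n0n; apply: le_lt_trans lt; apply: ub_le_sup; last by exists n.
exact/has_ubound_sdrop/bounded_fun_has_ubound.
Qed.

Lemma limn_sup_ge w c : bounded_fun (w : R^o^nat) ->
  (forall n0, exists2 n, (n0 <= n)%N & c <= w n) -> c <= limn_sup w.
Proof.
move=> wb h; rewrite leNgt; apply/negP => /(limn_sup_lt wb)[n0 hn0].
by have [n /hn0] := h n0; rewrite ltNge => /negP.
Qed.

Lemma limn_sup_le w c n0 : bounded_fun (w : R^o^nat) ->
  (forall n, (n0 <= n)%N -> w n <= c) -> limn_sup w <= c.
Proof.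
move=> wb h; rewrite limn_supE//; apply: (@le_trans _ _ (sups w n0)).
  apply: ge_inf; last by exists n0.
  exact: bounded_fun_has_lbound_sups.
by apply: ge_sup; [exists (w n0), n0 => /=|move=> _ [n /= nn0 <-]; exact: h].
Qed.

Lemma limn_sup_le_cvg w v l : (forall n, 0 <= w n <= v n) -> v @ \oo --> l ->
  bounded_fun (w : R^o^nat) /\ limn_sup w <= l.
Proof.
move=> wv vl.
have wb : bounded_fun (w : R^o^nat).
  have /cvg_seq_bounded[K [Kr Kv]] : cvg (v @ \oo) by apply/cvg_ex; exists l.
  exists K; split => // z Kz n _ /=.
  have /andP[w0 wvn] := wv n.
  by rewrite (ger0_norm w0) (le_trans wvn)// (le_trans (ler_norm _))// Kv.
split => //; apply/ler_addgt0Pr => e e0.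
move/cvgrPdist_le : vl => /(_ e e0)[n0 _ hn0].
apply: (limn_sup_le (n0 := n0) wb) => n n0n; have /andP[_ wvn] := wv n.
by apply: le_trans wvn _; have := hn0 n n0n; rewrite /= ler_distlC => /andP[].
Qed.

End LimSup.

(** * Totally bounded sets of operators *)

Section TotallyBounded.
Context (R : realType) (X : normedModType R[i]).
Implicit Types (M N : set (bounded_op X)).

(** The nets are taken inside M, so that they inherit whatever is known about the
    elements of M. *)
Definition totally_bounded M := forall e, 0 < e -> exists2 G : seq (bounded_op X),
  (forall g, g \in G -> M g) & forall a, M a -> exists2 g, g \in G & opnorm (a - g) <= e.

Lemma opnorm_ball (a b : bounded_op X) (e : R) : ball a e%:C%C b <-> opnorm (a - b) < e.
Proof. by rewrite -ball_normE /= rnormE ltcR rnorm_bounded_op. Qed.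

Lemma precompact_totally_bounded M : precompact M -> totally_bounded M.
Proof.
rewrite precompactE compact_cover => Mc e e0.
have [g Mg|a Ma|D DM Dc] := Mc _ M (fun g => ball g e%:C%C).
- exact: ball_open.
- have [|g [Mg ag]] := Ma (ball a e%:C%C).
    by apply: nbhsx_ballx; rewrite ltcE /= eqxx.
  by exists g => //; exact: ball_sym.
exists (finmap.enum_fset D).
  by move=> g gD; have := DM g gD; rewrite inE.
move=> a Ma; have [g gD] := Dc a (subset_closure Ma).
move=> /opnorm_ball ga; exists g => //.
by rewrite -rnorm_bounded_op rnormB_sym rnorm_bounded_op ltW.
Qed.

Lemma totally_bounded_bounded M : totally_bounded M ->
  exists2 K, 0 < K & forall a, M a -> opnorm a <= K.
Proof.
move=> /(_ 1 ltr01)[G GM Gc].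
pose K := \sum_(g <- G) opnorm g + 1.
have K0 : 0 < K by rewrite ltr_wpDl// sumr_ge0// => g _; exact: opnorm_ge0.
exists K => // a /Gc[g gG ag].
rewrite -rnorm_bounded_op; apply: le_trans (rnorm_le_sub a g) _.
rewrite addrC lerD//; rewrite rnorm_bounded_op (big_rem g)//= lerDl.
by rewrite sumr_ge0// => h _; exact: opnorm_ge0.
Qed.

Lemma totally_bounded_mul M N : totally_bounded M -> totally_bounded N ->
  totally_bounded (opset_mul M N).
Proof.
move=> tM tN e e0.
have [K K0 MK] := totally_bounded_bounded tM.
have [L L0 NL] := totally_bounded_bounded tN.
have eL : 0 < e / (2 * L) by rewrite divr_gt0// mulr_gt0.
have eK : 0 < e / (2 * K) by rewrite divr_gt0// mulr_gt0.
have [G GM Gc] := tM _ eL; have [H HN Hc] := tN _ eK.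
exists [seq op_comp g h | g <- G, h <- H].
  move=> _ /allpairsP[[g h] /= [gG hH ->]].
  by exists g; [exact: GM|exists h; [exact: HN|]].
move=> _ [a Ma [b Nb <-]].
have [g gG ag] := Gc a Ma; have [h hH bh] := Hc b Nb.
exists (op_comp g h); first by apply/allpairsP; exists (g, h).
have -> : op_comp a b - op_comp g h = op_comp (a - g) b + op_comp g (b - h).
  apply/val_inj/funext => x.
  suff : a (b x) - g (h x) = (a (b x) - g (b x)) + g (b x - h x) by [].
  by rewrite linearB addrA subrK.
rewrite -rnorm_bounded_op (le_trans (rnormD_le _ _))// !rnorm_bounded_op.
have -> : e = e / (2 * L) * L + K * (e / (2 * K)) by field; rewrite !gt_eqF.
apply: lerD; apply: le_trans (opnorm_comp _ _) _; apply: ler_pM; rewrite ?opnorm_ge0 ?NL//.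
exact/MK/GM.
Qed.

Lemma totally_bounded_exp M n : totally_bounded M -> totally_bounded (opset_exp M n).
Proof.
move=> tM; elim: n => [|n IH]; last exact: totally_bounded_mul.
move=> e e0; exists [:: op_id X] => [g|a ->]; first by rewrite inE => /eqP.
by exists (op_id X); rewrite ?mem_head// subrr -rnorm_bounded_op rnorm0 ltW.
Qed.

End TotallyBounded.

(** * The measure of non-compactness *)

Section Noncompactness.
Context (R : realType) (X : normedModType R[i]).
Implicit Types (M N : set (bounded_op X)) (T : bounded_op X).

Let chi_set T := [set e : R | 0 < e /\ exists2 F : set X, finite_set F &
  [set T x | x in [set x : X | `|x| <= 1]] `<=` \bigcup_(c in F) ball c e%:C%C].

Let chi_set_gt T e : opnorm T < e -> chi_set T e.
Proof.
move=> Te; have e0 : 0 < e := le_lt_trans (opnorm_ge0 T) Te.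
split => //; exists [set 0]; first exact: finite_set1.
move=> _ [x /= x1 <-]; exists 0 => //.
by rewrite -ball_normE /= sub0r normrN rnormE ltcR (le_lt_trans _ Te)// opnorm_ge.
Qed.

Let chi_set_lb T : has_lbound (chi_set T).
Proof. by exists 0 => e [/ltW]. Qed.

Lemma chi_norm_ge0 T : 0 <= chi_norm T.
Proof.
apply: lb_le_inf; first by exists (opnorm T + 1); apply: chi_set_gt; rewrite ltrDl.
by move=> e [/ltW].
Qed.

Lemma chi_norm_le T : chi_norm T <= opnorm T.
Proof.
apply/ler_addgt0Pr => e e0; apply: ge_inf; first exact: chi_set_lb.
by apply: chi_set_gt; rewrite ltrDl.
Qed.

Lemma chi_norm_lt T c : chi_norm T < c -> exists F : seq X,
  forall u, rnorm u <= 1 -> exists2 f, f \in F & rnorm (T u - f) <= c.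
Proof.
move=> /inf_lt[|e [e0 [_ /finite_seqP[F ->] TF]] ec].
  by exists (opnorm T + 1); apply: chi_set_gt; rewrite ltrDl.
exists F => u u1; have [|f /= fF] := TF (T u).
  by exists u => //=; rewrite rnormE -(rmorph1 (real_complex R)) lecR.
rewrite -ball_normE /= rnormE ltcR rnormB_sym => fu; exists f => //.
by rewrite (le_trans (ltW fu))// ltW.
Qed.

(** One finite set serves all of M: take the finite covers of the members of a net
    and enlarge the radius by the mesh of the net. *)
Lemma ball_cover_chi M c t : totally_bounded M -> c < t ->
  (forall a, M a -> chi_norm a < c) -> exists F, ball_cover M F t.
Proof.
move=> tM ct Mc.
have tc : 0 < t - c by rewrite subr_gt0.
have [G GM Gc] := tM _ tc.
have H g : exists F : seq X, M g ->
    forall u, rnorm u <= 1 -> exists2 f, f \in F & rnorm (g u - f) <= c.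
  have [Mg|nMg] := pselect (M g); last by exists [::].
  by have [F hF] := chi_norm_lt (Mc g Mg); exists F.
have [F hF] := choice H.
exists (flatten [seq F g | g <- G]) => a u Ma u1.
have [g gG ag] := Gc a Ma; have [f fF gf] := hF g (GM g gG) u u1.
exists f; first by apply/flattenP; exists (F g) => //; exact: map_f.
apply: le_trans (rnorm_triangle (g u) _ _) _.
have -> : t = (t - c) + c by rewrite subrK.
apply: lerD => //; apply: le_trans ag.
rewrite -[a u - g u]/((a - g) u) (le_trans (opnormP _ _))//.
by rewrite ler_piMr// opnorm_ge0.
Qed.

End Noncompactness.

(** * Radii dominated by the norm *)

Section SupremumOverSet.
Context (R : realType) (X : normedModType R[i]).
Implicit Types (M N : set (bounded_op X)) (f : bounded_op X -> R).

Lemma sup_image_ge M c f a : (forall b, M b -> opnorm b <= c) ->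
  (forall b, f b <= opnorm b) -> M a -> f a <= sup [set f b | b in M].
Proof.
move=> Mc fb Ma; apply: ub_le_sup; last by exists a.
by exists c => _ [b Mb <-]; exact: le_trans (fb b) (Mc b Mb).
Qed.

Lemma sup_image_le M c f : (forall b, M b -> opnorm b <= c) ->
  (forall b, 0 <= f b <= opnorm b) -> 0 <= sup [set f b | b in M] <= opset_norm M.
Proof.
move=> Mc fb; have [[b Mb]|/set0P/negP/negPn/eqP->] := pselect (M !=set0); last first.
  by rewrite /opset_norm !image_set0 sup0 lexx.
have fb1 b' : f b' <= opnorm b' by case/andP: (fb b').
apply/andP; split.
  by apply: le_trans (sup_image_ge Mc fb1 Mb); case/andP: (fb b).
apply: ge_sup; first by exists (f b), b.
by move=> _ [d Md <-]; apply: le_trans (fb1 d) _; exact: opset_norm_ge Mc Md.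
Qed.

Lemma limn_sup_le_joint M f : op_bounded M -> (forall b, 0 <= f b <= opnorm b) ->
  let w := fun n => sup [set f a | a in opset_exp M n] `^ n%:R^-1 in
  bounded_fun (w : R^o^nat) /\ limn_sup w <= joint_spectral_radius M.
Proof.
move=> Mb fb w; have := joint_spectral_radius_cvg Mb.
rewrite -joint_spectral_radiusE//; apply: limn_sup_le_cvg => n.
rewrite powR_ge0 /=; have [c hc] := op_bounded_exp Mb n.
have /andP[s0 sle] := sup_image_le hc fb.
by apply: ge0_ler_powR; rewrite ?nnegrE ?invr_ge0 ?opset_norm_ge0.
Qed.

End SupremumOverSet.

(** * Scaling a set of operators *)

Section Scaling.
Context (R : realType) (X : normedModType R[i]).
Implicit Types (M N : set (bounded_op X)).

Definition scale_set (r : R) M := [set r%:C%C *: a | a in M].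

Lemma op_comp_scale (z w : R[i]) (a b : bounded_op X) :
  op_comp (z *: a) (w *: b) = (z * w) *: op_comp a b.
Proof.
apply/val_inj/funext => x.
suff : z *: a (w *: b x) = (z * w) *: a (b x) by [].
by rewrite linearZ /= scalerA.
Qed.

Lemma opset_exp_scale r M n : opset_exp (scale_set r M) n = scale_set (r ^+ n) (opset_exp M n).
Proof.
elim: n => [|n IH].
  apply/seteqP; split=> [_ ->|_ [_ -> <-]]; last by rewrite expr0 rmorph1 scale1r.
  by exists (op_id X) => //; rewrite expr0 rmorph1 scale1r.
rewrite !opset_expS IH; apply/seteqP; split.
  move=> _ [_ [a Ma <-] [_ [b Mb <-] <-]].
  exists (op_comp a b); first by exists a => //; exists b.
  by rewrite op_comp_scale -rmorphM -exprS.
move=> _ [_ [a Ma [b Mb <-]] <-].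
exists (r%:C%C *: a); first by exists a.
exists ((r ^+ n)%:C%C *: b); first by exists b.
by rewrite op_comp_scale -rmorphM -exprS.
Qed.

Lemma op_pow_scale (r : R) (a : bounded_op X) p :
  op_pow (r%:C%C *: a) p = (r ^+ p)%:C%C *: op_pow a p.
Proof.
elim: p => [|p IH]; first by rewrite expr0 rmorph1 scale1r.
by rewrite /= -/(op_pow _ p) IH op_comp_scale -rmorphM -exprS.
Qed.

Lemma opnorm_scale (r : R) (a : bounded_op X) : 0 <= r -> opnorm (r%:C%C *: a) = r * opnorm a.
Proof. by move=> r0; rewrite -!rnorm_bounded_op rnormZ modc_real ger0_norm. Qed.

Lemma op_powD (a : bounded_op X) p q : op_pow a (p + q) = op_comp (op_pow a p) (op_pow a q).
Proof.
elim: p => [|p IH]; first by rewrite op_1comp.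
by rewrite addSn /= -!/(op_pow _ _) IH op_compA.
Qed.

Lemma op_powM (a : bounded_op X) p q : op_pow (op_pow a p) q = op_pow a (p * q).
Proof.
elim: q => [|q IH]; first by rewrite muln0.
by rewrite mulnS op_powD -IH.
Qed.

End Scaling.

(** * The generalised Berger-Wang formula *)

Section BergerWang.
Context (R : realType) (X : normedModType R[i]).
Implicit Types (M N : set (bounded_op X)).

Lemma chi_bounds (T : bounded_op X) : 0 <= chi_norm T <= opnorm T.
Proof. by rewrite chi_norm_ge0 chi_norm_le. Qed.

Lemma spectral_bounds (T : bounded_op X) : 0 <= spectral_radius T <= opnorm T.
Proof. by rewrite spectral_radius_ge0 spectral_radius_le. Qed.

Lemma totally_bounded_op_bounded M : totally_bounded M -> op_bounded M.
Proof.
by move=> /totally_bounded_bounded[K _ MK]; exists K => b; rewrite opset_exp1; exact: MK.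
Qed.

(** After division by the joint spectral radius rho, [near_eigenvector] with
    g = 1/t, for t between th and 1, gives a product a of length n with spectral
    radius at least (t rho)^n; its powers do the same at arbitrarily large
    lengths. *)
Lemma berger_wang_ge M th : totally_bounded M -> 0 < th < 1 ->
  0 < joint_spectral_radius M ->
  chi_spectral_radius M < th * joint_spectral_radius M ->
  th * joint_spectral_radius M <= berger_wang_radius M.
Proof.
move=> tM /andP[th0 th1]; set rho := joint_spectral_radius M => rho0 chi_lt.
have Mb := totally_bounded_op_bounded tM.
have [chib _] := limn_sup_le_joint Mb chi_bounds.
have [bwb _] := limn_sup_le_joint Mb spectral_bounds.
have ri0 : 0 < rho^-1 by rewrite invr_gt0.
pose M' := scale_set rho^-1 M.
have [n0 chi_n] := limn_sup_lt chib chi_lt.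
pose t := (1 + th) / 2.
have t0 : 0 < t by rewrite /t; lra.
have t1 : t < 1 by rewrite /t; lra.
have tht : th < t by rewrite /t; lra.
have Mbig n c : (0 < n)%N -> c < 1 -> exists2 b, opset_exp M' n b & c < opnorm b.
  move=> n_gt0 c1.
  have rn := joint_spectral_radius_lower Mb n_gt0.
  have rhon : 0 < rho ^+ n by rewrite exprn_gt0.
  have lt : c * rho ^+ n < opset_norm (opset_exp M n).
    by apply: lt_le_trans rn; rewrite gtr_pMl.
  have [Mn0|Mn0] := pselect (opset_exp M n !=set0); last first.
    have := rn; rewrite leNgt => /negP[].
    by rewrite (_ : opset_norm _ = 0)//; move/set0P/negP/negPn/eqP: Mn0 => ->;
       rewrite /opset_norm image_set0 sup0.
  have [|_ [a Ma <-] ca] := sup_gt _ lt.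
    by case: Mn0 => a Ma; exists (opnorm a), a.
  rewrite /M' opset_exp_scale; exists ((rho^-1 ^+ n)%:C%C *: a); first by exists a.
  rewrite opnorm_scale ?exprn_ge0 ?(ltW ri0)//.
  by rewrite exprVn mulrC ltr_pdivlMr.
have Mgrowth : subexp_growth M'.
  move=> e e0; have lt : rho < rho * (1 + e) by rewrite ltr_pMr// ltrDl.
  have [C C0 hC] := joint_spectral_radius_upper Mb lt.
  exists C => // n b; rewrite /M' opset_exp_scale => -[a Ma <-].
  rewrite opnorm_scale ?exprn_ge0 ?(ltW ri0)// exprVn ler_pdivrMl ?exprn_gt0//.
  by apply: le_trans (hC n a Ma) _; rewrite exprMn mulrCA.
have Mcov m : (n0.+1 <= m)%N -> exists F, ball_cover (opset_exp M' m) F (t ^+ m).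
  move=> n0m; have m0 : (0 < m)%N by apply: leq_ltn_trans n0m.
  have lt : (th * rho) ^+ m < (t * rho) ^+ m.
    by rewrite ltrXn2r -?lt0n// ?nnegrE ?mulr_ge0 ?ltW ?ltr_pM2r.
  pose c := ((th * rho) ^+ m + (t * rho) ^+ m) / 2.
  have c1 : (th * rho) ^+ m < c by rewrite /c; lra.
  have c2 : c < (t * rho) ^+ m by rewrite /c; lra.
  have [F hF] : exists F, ball_cover (opset_exp M m) F ((t * rho) ^+ m).
    apply: (ball_cover_chi (totally_bounded_exp m tM) c2) => a Ma.
    apply: le_lt_trans c1.
    have [d hd] := op_bounded_exp Mb m.
    apply: le_trans (sup_image_ge hd (@chi_norm_le _ _) Ma) _.
    have := ltW (chi_n m (ltnW n0m)); rewrite root_le//.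
      by case/andP: (sup_image_le hd chi_bounds).
    by rewrite mulr_ge0// ltW.
  exists [seq (rho^-1 ^+ m)%:C%C *: f | f <- F] => b u.
  rewrite /M' opset_exp_scale => -[a Ma <-] u1.
  have [f fF af] := hF a u Ma u1.
  exists ((rho^-1 ^+ m)%:C%C *: f); first exact: map_f.
  rewrite -[X in X - _]/((rho^-1 ^+ m)%:C%C *: a u) -scalerBr rnormZ modc_real.
  rewrite ger0_norm ?exprn_ge0 ?(ltW ri0)// exprVn ler_pdivrMl ?exprn_gt0//.
  by apply: le_trans af _; rewrite exprMn mulrC.
have g1 : 1 < t^-1 by rewrite invf_gt1.
have t01 : 0 < t < 1 by rewrite t0.
have [n [b [v [n_gt0 Mb' v0 bv]]]] := near_eigenvector Mbig Mgrowth t01 Mcov g1.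
move: Mb'; rewrite /M' opset_exp_scale => -[a Ma ab].
have tr0 : 0 < t * rho by rewrite mulr_gt0.
apply: limn_sup_ge bwb _ => N.
exists (n * N.+1)%N; first by rewrite (leq_trans (leqnSn N))// leq_pmull.
have nN : (0 < n * N.+1)%N by rewrite muln_gt0 n_gt0.
have [d hd] := op_bounded_exp Mb (n * N.+1).
have thr : 0 <= th * rho by rewrite mulr_ge0// ltW.
rewrite root_ge//; last by case/andP: (sup_image_le hd spectral_bounds).
apply: le_trans (sup_image_ge hd (@spectral_radius_le _ _) (opset_exp_pow N.+1 Ma)).
apply: (@le_trans _ _ ((t * rho) ^+ (n * N.+1))).
  by apply: lerXn2r; rewrite ?nnegrE// ?(ltW tr0)// ler_pM2r// ltW.
have -> : (t * rho) ^+ (n * N.+1) = (((t * rho)^-1) ^+ (n * N.+1))^-1.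
  by rewrite exprVn invrK.
apply: spectral_radius_ge v0 _ _; first by rewrite exprn_gt0// invr_gt0.
move=> p; rewrite op_powM; apply: le_trans (bv (N.+1 * p)%N) _.
rewrite -ab op_pow_scale.
rewrite -[X in _ * rnorm X]/((rho^-1 ^+ n ^+ (N.+1 * p))%:C%C *: op_pow a (N.+1 * p) v).
rewrite rnormZ modc_real ger0_norm ?exprn_ge0 ?exprn_ge0 ?(ltW ri0)//.
by rewrite mulrA -!exprM -exprMn -invfM mulnA.
Qed.

(** If max(c, b) < rho, a factor th with max(c, b) < th * rho < rho contradicts the
    last hypothesis. *)
Lemma eq_max_of_threshold (rho c b : R) : 0 <= b -> c <= rho -> b <= rho ->
  (forall th, 0 < th < 1 -> 0 < rho -> c < th * rho -> th * rho <= b) ->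
  rho = Num.max c b.
Proof.
move=> b0 c_le b_le h; apply/eqP; rewrite eq_le ge_max c_le b_le !andbT.
rewrite leNgt; apply/negP => mu_lt; set mu := Num.max c b in mu_lt.
have mu0 : 0 <= mu by rewrite le_max b0 orbT.
have rho0 : 0 < rho by apply: le_lt_trans mu_lt.
pose th := (1 + mu / rho) / 2.
have q1 : mu / rho < 1 by rewrite ltr_pdivrMr// mul1r.
have q0 : 0 <= mu / rho by rewrite divr_ge0// ltW.
have th01 : 0 < th < 1 by rewrite /th; lra.
have mu_th : mu < th * rho by rewrite -ltr_pdivrMr// /th; lra.
have c_th : c < th * rho by apply: le_lt_trans mu_th; rewrite le_max lexx.
have := h th th01 rho0 c_th; apply/negP; rewrite -ltNge.
by apply: le_lt_trans mu_th; rewrite le_max lexx orbT.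
Qed.

Lemma joint_spectral_radius_totally_bounded M : totally_bounded M ->
  joint_spectral_radius M = Num.max (chi_spectral_radius M) (berger_wang_radius M).
Proof.
move=> tM; have Mb := totally_bounded_op_bounded tM.
have [bwb bw_le] := limn_sup_le_joint Mb spectral_bounds.
apply: eq_max_of_threshold.
- by apply: limn_sup_ge bwb _ => n; exists n => //; exact: powR_ge0.
- exact: (limn_sup_le_joint Mb chi_bounds).2.
- exact: bw_le.
- by move=> th th01 rho0; exact: berger_wang_ge.
Qed.

End BergerWang.

Theorem theorem4p6 (R : realType) (X : completeNormedModType R[i])
    (M : set (bounded_op X)) (hM : precompact M) :
  joint_spectral_radius M =
    Num.max (chi_spectral_radius M) (berger_wang_radius M).
Proof. exact/joint_spectral_radius_totally_bounded/precompact_totally_bounded. Qed.
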